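(* Let $H\in(0,\tfrac12)$, $x_0,a,\sigma>0$, $T>0$, and let $X^H$ be the rough Bessel process with these (unknown) parameters, observed at the points $t_k=\frac{kT}{n}$, $k=0,\dots,n$, of the fixed interval $[0,T]$. Then the estimator $$\widehat H:=\frac{\log\left(4-\frac{V^n_{2,2}(X^H)}{V^n_{1,2}(X^H)}\right)}{2\log 2}$$ is a (weakly) consistent estimator of the Hurst index $H$, i.e. $\widehat H\to H$ in probability as $n\to\infty$.
   Context: $B^H=\{B^H(t),\ t\ge0\}$ is a fractional Brownian motion with Hurst index $H\in(0,\frac12)$: a centered Gaussian process with $\mathbb E[B^H(t)B^H(s)]=\frac12(t^{2H}+s^{2H}-|t-s|^{2H})$, $s,t\ge0$, always taken in its modification with paths locally Hölder continuous of every order $\lambda\in(0,H)$. For constants $x_0,a,\sigma>0$ and each $\varepsilon>0$, $X^H_\varepsilon$ is the unique pathwise solution of $$X^H_\varepsilon(t)=x_0+\int_0^t\frac{a}{X^H_\varepsilon(s)\mathbf 1_{\{X^H_\varepsilon(s)>0\}}+\varepsilon}\,ds+\sigma B^H(t),\qquad t\ge0.$$ For $\varepsilon_1<\varepsilon_2$ one has $X^H_{\varepsilon_1}(t)\ge X^H_{\varepsilon_2}(t)$ for all $t$, so the pointwise limit $X^H(t):=\lim_{\varepsilon\downarrow0}X^H_\varepsilon(t)$ exists; it is called the rough (fractional) Bessel process. With probability 1, $X^H(t)<\infty$ and $X^H(t)\ge0$ for all $t\ge0$, and $X^H(t)>0$ for almost all $t\ge0$. For a process $\xi=\{\xi(t),\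 t\in[0,T]\}$ and $t_k=\frac{kT}{n}$, $$V^n_{1,2}(\xi):=\sum_{k=0}^{n-1}(\xi(t_{k+1})-\xi(t_k))^2,\qquad V^n_{2,2}(\xi):=\sum_{k=0}^{n-2}(\xi(t_{k+2})-2\xi(t_{k+1})+\xi(t_k))^2.$$ *)

(* Defs.v *)
From mathcomp Require Import all_boot all_order all_algebra.
From mathcomp Require Import all_classical all_reals all_analysis.

Set Implicit Arguments.
Unset Strict Implicit.
Unset Printing Implicit Defensive.

Import Order.TTheory GRing.Theory Num.Theory.
Import numFieldNormedType.Exports.

Local Open Scope classical_set_scope.
Local Open Scope ring_scope.

(* All processes are indexed by the whole of R for convenience; only their
   values at times t >= 0 are ever constrained or used. *)

(* [normal_prob m 0] is not the point mass at m in the library, so the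
   degenerate Gaussian law is treated separately. *)
Definition gaussian_rv (d : measure_display) (Omega : measurableType d)
    (R : realType) (P : probability Omega R) (Y : Omega -> R) : Prop :=
  exists m s : R, forall A : set R, measurable A ->
    P (Y @^-1` A) = if s == 0 then \d_m A else normal_prob m s A.

(* Joint Gaussianity of the finite-dimensional distributions, expressed by
   requiring every linear combination to be (possibly degenerate) Gaussian. *)
Definition gaussian_process (d : measure_display) (Omega : measurableType d)
    (R : realType) (P : probability Omega R) (B : R -> {RV P >-> R}) : Prop :=
  forall (n : nat) (t c : 'I_n -> R), (forall i, 0 <= t i) ->
    gaussian_rv P (fun w => \sum_(i < n) c i * B (t i) w).

Definition locally_hoelder (R : realType) (lambda : R) (f : R -> R) : Prop :=
  forall M : R, 0 < M -> exists C : R, forall s t : R,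
    0 <= s <= M -> 0 <= t <= M -> `|f t - f s| <= C * `|t - s| `^ lambda.

Definition fractional_brownian_motion (d : measure_display)
    (Omega : measurableType d) (R : realType) (P : probability Omega R)
    (H : R) (B : R -> {RV P >-> R}) : Prop :=
  [/\ gaussian_process B,
      (forall t : R, 0 <= t -> ('E_P[B t] = 0)%E),
      (forall t s : R, 0 <= t -> 0 <= s -> ('E_P[B t \* B s])%E =
         (2^-1 * (t `^ (2 * H) + s `^ (2 * H) - `|t - s| `^ (2 * H)))%:E) &
      (forall (w : Omega) (lambda : R), 0 < lambda < H ->
         locally_hoelder lambda (fun t => B t w))].

(* [b] is a path of the driving noise and [x] the path of the solution;
   the factor [(0 < x s)%R%:R] is the indicator of {x s > 0}. *)
Definition regularized_solution (R : realType) (x0 a sigma eps : R)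
    (b x : R -> R) : Prop :=
  {within `[0, +oo[, continuous x} /\
  forall t : R, 0 <= t ->
    x t = x0
          + \int[lebesgue_measure]_(s in `[0, t])
              (a / (x s * (0 < x s)%R%:R + eps))
          + sigma * b t.

(* The limit exists in the extended reals by monotonicity in eps, and is
   almost surely finite; hence X is extended-real valued. *)
Definition rough_bessel_process (d : measure_display)
    (Omega : measurableType d) (R : realType) (P : probability Omega R)
    (x0 a sigma : R) (B : R -> {RV P >-> R}) (X : R -> Omega -> \bar R) : Prop :=
  exists Xeps : R -> R -> {RV P >-> R},
    (forall eps : R, 0 < eps -> forall w : Omega,
       regularized_solution x0 a sigma eps
         (fun t => B t w) (fun t => Xeps eps t w)) /\
    (forall (t : R) (w : Omega), 0 <= t -> (Xeps eps t w)%:E @[eps --> 0^'+] --> X t w).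

Definition grid (R : realType) (T : R) (n k : nat) : R := k%:R * T / n%:R.

Definition V12 (R : realType) (T : R) (n : nat) (xi : R -> R) : R :=
  \sum_(k < n) (xi (grid T n k.+1) - xi (grid T n k)) ^+ 2.

Definition V22 (R : realType) (T : R) (n : nat) (xi : R -> R) : R :=
  \sum_(k < n.-1) (xi (grid T n k.+2) - 2 * xi (grid T n k.+1)
                   + xi (grid T n k)) ^+ 2.

(* [ln] is 0 on nonpositive reals and division by 0 gives 0, so the estimator
   is total; neither convention affects convergence in probability. *)
Definition hurst_estimator (R : realType) (T : R) (n : nat) (xi : R -> R) : R :=
  ln (4 - V22 T n xi / V12 T n xi) / (2 * ln 2).

Definition cvg_in_probability (d : measure_display) (Omega : measurableType d)
    (R : realType) (P : probability Omega R) (Y : nat -> Omega -> R) (c : R) :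
    Prop :=
  forall delta : R, 0 < delta ->
    P [set w | delta < `|Y n w - c|] @[n --> \oo] --> 0%E.

(* Main.v *)
(* Write X = x0 + D + sigma * B, where D t is the limit of the drift integrals.
   Along every path D is nondecreasing and finite: after the last time the
   regularized solution is at most 1 its drift is at most a, whatever eps, and at
   that time the equation bounds the drift accumulated so far. Hence the squared
   increments of D sum to at most (D T)^2, whereas the quadratic variation of
   sigma * B on the grid is of order n^(1 - 2 H), which tends to infinity because
   H < 1/2. So V12 and V22 of X behave like those of sigma * B.

   For B, the variance of a sum of squares of centered jointly Gaussian variables
   is twice the sum of the squared covariances. Increments of B over disjoint grid
   cells are nonpositively correlated since t^(2 H) is concave, and all their
   covariances sum to the second moment of the total increment, which is
   nonnegative; so the squared covariances sum to at most 2 n (T / n)^(4 H).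
   Chebyshev's inequality then gives V12 ~ n (T / n)^(2 H) and
   V22 ~ (4 - 2^(2 H)) n (T / n)^(2 H). *)

Require Import Defs.
From mathcomp Require Import all_boot all_order all_algebra.
From mathcomp Require Import all_classical all_reals all_analysis.
From mathcomp Require Import measurable_realfun ring lra.

Import Order.TTheory GRing.Theory Num.Theory.
Import numFieldNormedType.Exports.

Local Open Scope classical_set_scope.
Local Open Scope ring_scope.

(** * Moments of Gaussian laws *)

Section integrable_EFin.
Context {d} {T : measurableType d} {R : realType} {mu : {measure set T -> \bar R}}.
Implicit Types f g : T -> R.

Lemma integrable_EFinD f g : mu.-integrable setT (EFin \o f) ->
  mu.-integrable setT (EFin \o g) ->
  mu.-integrable setT (EFin \o (fun x => f x + g x)).
Proof. by move=> fi gi; exact: (integrableD _ fi gi). Qed.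

Lemma integrable_EFinB f g : mu.-integrable setT (EFin \o f) ->
  mu.-integrable setT (EFin \o g) ->
  mu.-integrable setT (EFin \o (fun x => f x - g x)).
Proof. by move=> fi gi; exact: (integrableB _ fi gi). Qed.

Lemma integrable_EFinZ (c : R) f : mu.-integrable setT (EFin \o f) ->
  mu.-integrable setT (EFin \o (fun x => c * f x)).
Proof. by move=> fi; exact: (integrableZl _ c fi). Qed.

Lemma integrable_EFin_sum I (r : seq I) (f : I -> T -> R) :
  (forall i, mu.-integrable setT (EFin \o f i)) ->
  mu.-integrable setT (EFin \o (fun x => \sum_(i <- r) f i x)).
Proof.
move=> fi; elim: r => [|i r ih].
  under eq_fun do rewrite big_nil.
  exact: integrable0.
under eq_fun do rewrite big_cons.
exact: integrable_EFinD.
Qed.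

Lemma Rintegral_sum I (r : seq I) (f : I -> T -> R) :
  (forall i, mu.-integrable setT (EFin \o f i)) ->
  \int[mu]_x (\sum_(i <- r) f i x) = \sum_(i <- r) \int[mu]_x f i x.
Proof.
move=> fi; elim: r => [|i r ih].
  by under eq_Rintegral do rewrite big_nil; rewrite big_nil Rintegral_cst ?mul0r.
under eq_Rintegral do rewrite big_cons.
by rewrite RintegralD ?ih ?big_cons//; exact: integrable_EFin_sum.
Qed.

End integrable_EFin.

Section normal_moments.
Context {R : realType}.
Implicit Types (m s x : R) (k : nat).
Local Notation mu := (@lebesgue_measure R).

(** The Radon-Nikodym derivative of [normal_prob m s] has the same integral as [normal_pdf m s] over
    every measurable set, so the two agree almost everywhere. *)
Lemma ge0_integral_normal_prob m s (g : R -> \bar R) :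
  measurable_fun [set: R] g -> (forall x, 0 <= g x)%E ->
  (\int[normal_prob m s]_x g x = \int[mu]_x (g x * (normal_pdf m s x)%:E))%E.
Proof.
move=> mg g0.
have dom := normal_prob_dominates m s.
rewrite -(Radon_Nikodym_SigmaFinite.change_of_variables dom)//.
apply: ae_eq_integral => //.
- apply: emeasurable_funM => //.
  exact: (measurable_int _ (Radon_Nikodym_SigmaFinite.f_integrable _)).
- apply: emeasurable_funM => //.
  by apply/measurable_EFinP; exact: measurable_normal_pdf.
- apply: ae_eqe_mul2l => /=.
  apply: integral_ae_eq => //.
  + exact: Radon_Nikodym_SigmaFinite.f_integrable.
  + by apply/measurable_EFinP; exact: measurable_normal_pdf.
  + by move=> A _ mA; rewrite -Radon_Nikodym_SigmaFinite.f_integral.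
Qed.

(** Split off two factors [expR (- (3/8 * z))]. Since [1 + y <= expR y], each product
    [z * expR (- (3/8 * z))] is at most 8/3, and (8/3)^2 < 8. The remaining quarter of the exponent
    is that of a normal density with doubled standard deviation. *)
Lemma sqr_expRN_le (z : R) : 0 <= z -> z ^+ 2 * expR (- z) <= 8 * expR (- (z / 4)).
Proof.
move=> z0.
have -> : expR (- z) = expR (- (3/8 * z)) ^+ 2 * expR (- (z / 4)).
  by rewrite expr2 -!expRD; congr expR; field.
rewrite mulrA ler_wpM2r ?expR_ge0// -exprMn.
have : z * expR (- (3 / 8 * z)) <= 8 / 3.
  rewrite expRN ler_pdivrMr ?expR_gt0//.
  have := expR_ge1Dx (3 / 8 * z); lra.
have : 0 <= z * expR (- (3 / 8 * z)) by rewrite mulr_ge0 ?expR_ge0.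
nra.
Qed.

(** The fundamental theorem of calculus applies on [[m - n, m + n]]; dominated convergence, with
    [|f|] as dominating function, lets n tend to infinity. *)
Lemma integral_derivative_eq0 (F f : R -> R) m :
  (forall x, is_derive x 1 F (f x)) -> continuous f ->
  mu.-integrable setT (EFin \o f) ->
  F (m + n%:R) @[n --> \oo] --> 0 -> F (m - n%:R) @[n --> \oo] --> 0 ->
  (\int[mu]_x (f x)%:E = 0)%E.
Proof.
move=> dF cf intf Fp Fm.
pose D n := `[m - n%:R, m + n%:R]%classic.
have mD n : measurable (D n) by exact: measurable_itv.
have [|||||_ _ key] := @dominated_convergence _ _ _ mu setT measurableT
     (fun n => EFin \o (f \_ (D n))) (EFin \o f) (abse \o (EFin \o f)) => //.
  - move=> n; apply/measurable_EFinP; apply/(measurable_restrictT _ (mD n)).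
    exact: measurable_funTS (continuous_measurable_fun cf).
  - by apply/measurable_EFinP; exact: continuous_measurable_fun.
  - apply: aeW => x _; apply: cvg_near_cst.
    near=> n; rewrite /= patchE mem_set// /D/= in_itv/=.
    have : `|x - m| <= n%:R by near: n; exact: nbhs_infty_ger.
    by rewrite ler_norml => /andP[? ?]; apply/andP; split; lra.
  - exact: integrable_abse.
  - apply: aeW => x n _ /=; rewrite patchE; case: ifPn => // _.
    by rewrite normr0 lee_fin.
have val : \forall n \near \oo, (\int[mu]_x (EFin \o (f \_ (D n))) x)%E =
    (F (m + n%:R) - F (m - n%:R))%:E.
  near=> n.
  have n0 : (0 < n)%N by near: n; exact: nbhs_infty_gt.
  have := @continuous_FTC2 R f F (m - n%:R) (m + n%:R).
  rewrite integral_mkcond -restrict_EFin => -> //.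
  - have : 0 < n%:R :> R by rewrite ltr0n.
    lra.
  - exact: continuous_subspaceT.
  - have dc x : {for x, continuous F}.
      apply: differentiable_continuous; apply/derivable1_diffP.
      by have := dF x => /(@ex_derive _ _ _ _ _ _ _).
    split.
    + by move=> x _; exact: ex_derive.
    + exact: cvg_at_right_filter (dc _).
    + exact: cvg_at_left_filter (dc _).
  - by move=> x _; rewrite derive1E; exact: derive_val.
have : (fun n => \int[mu]_x (EFin \o (f \_ (D n))) x)%E @ \oo --> 0%E.
  apply: (@cvg_trans _ ((F (m + n%:R) - F (m - n%:R))%:E @[n --> \oo])).
    apply: near_eq_cvg; near=> n; apply/esym; near: n; exact: val.
  apply: cvg_EFin; first exact: nearW.
  rewrite -[X in _ --> X](subr0 0).
  exact: cvgB.
by move/cvg_unique: key => /[apply] ->.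
Unshelve. all: by end_near.
Qed.

(** With z = (x - m)^2 / (2 s^2) one has (x - m)^4 = 4 s^4 z^2, and [sqr_expRN_le] supplies the
    other factor 8 of 32. This one bound serves both for integrability of the moments and for their
    decay at infinity. *)
Lemma normal_pdf_fourth_moment_le m s x : s != 0 ->
  (x - m) ^+ 4 * normal_pdf m s x <=
  32 * s ^+ 4 * normal_peak s * expR (- ((x - m) ^+ 2 / (s ^+ 2 *+ 2) / 4)).
Proof.
move=> s0; rewrite normal_pdfE// /normal_fun mulNr.
have s2 : 0 < s ^+ 2 by rewrite exprn_even_gt0.
set z := (x - m) ^+ 2 / (s ^+ 2 *+ 2).
have -> : (x - m) ^+ 4 = 4 * s ^+ 4 * z ^+ 2 by rewrite /z -mulr_natr; field.
have z0 : 0 <= z by rewrite divr_ge0 ?sqr_ge0// mulrn_wge0// sqr_ge0.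
have := sqr_expRN_le _ z0.
have c0 : 0 <= 4 * s ^+ 4 * normal_peak s.
  apply: mulr_ge0 (normal_peak_ge0 _); apply: mulr_ge0 => //.
  exact: exprn_even_ge0.
move=> /(ler_wpM2l c0); lra.
Qed.

Lemma exprn_le_1D4 (y : R) k : (k <= 4)%N -> `|y ^+ k| <= 1 + y ^+ 4.
Proof.
move=> k4; have y4 : 0 <= y ^+ 4 by rewrite exprn_even_ge0.
rewrite normrX; have [y1|y1] := leP `|y| 1.
  by rewrite (le_trans (exprn_ile1 _ _ y1))// lerDl.
rewrite (@le_trans _ _ (`|y| ^+ 4))//; first by rewrite ler_eXn2l.
by rewrite -normrX ger0_norm// lerDr.
Qed.

Lemma integrable_normal_moment m s k : s != 0 -> (k <= 4)%N ->
  mu.-integrable setT (EFin \o (fun x => (x - m) ^+ k * normal_pdf m s x)).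
Proof.
move=> s0 k4.
(* The quotient of peaks makes [C * normal_pdf m (2 * s)] equal to the bound of
   [normal_pdf_fourth_moment_le]. *)
pose C := 32 * s ^+ 4 * normal_peak s / normal_peak (2 * s).
have s20 : 2 * s != 0 by rewrite mulf_neq0.
apply: (@le_integrable _ _ _ mu setT _ _
  (EFin \o (fun x => normal_pdf m s x + C * normal_pdf m (2 * s) x))) => //.
- apply/measurable_EFinP; apply: measurable_funM; last exact: measurable_normal_pdf.
  by apply: measurable_funX; exact: measurable_funB.
- move=> x _ /=; rewrite lee_fin.
  have p0 := normal_pdf_ge0 m s x.
  have -> : C * normal_pdf m (2 * s) x =
      32 * s ^+ 4 * normal_peak s * expR (- ((x - m) ^+ 2 / (s ^+ 2 *+ 2) / 4)).
    rewrite (normal_pdfE _ s20) /normal_fun /C mulrA divfK; last first.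
      by rewrite gt_eqF// normal_peak_gt0.
    by congr (_ * expR _); field.
  have := normal_pdf_fourth_moment_le m s x s0.
  set E := expR _ => h.
  have E0 : 0 <= 32 * s ^+ 4 * normal_peak s * E.
    apply: mulr_ge0 (expR_ge0 _); apply: mulr_ge0 (normal_peak_ge0 _).
    by apply: mulr_ge0 => //; exact: exprn_even_ge0.
  rewrite [leRHS]ger0_norm ?addr_ge0// normrM (ger0_norm p0).
  rewrite (@le_trans _ _ ((1 + (x - m) ^+ 4) * normal_pdf m s x))//.
    by rewrite ler_wpM2r// exprn_le_1D4.
  by rewrite mulrDl mul1r lerD2l.
- apply: integrable_EFinD; first exact: integrable_normal_pdf.
  by apply: integrable_EFinZ; exact: integrable_normal_pdf.
Qed.

Lemma is_derive_normal_pdf m s x : s != 0 ->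
  is_derive x 1 (normal_pdf m s) (- ((x - m) / s ^+ 2) * normal_pdf m s x).
Proof.
move=> s0; have -> : normal_pdf m s = normal_peak s \*:
    (expR \o (- (s ^+ 2 *+ 2)^-1 \*: ((id - cst m) ^+ 2))).
  rewrite normal_pdfE//; apply/funext => y /=; rewrite /normal_fun mulNr.
  by congr (_ * expR _); rewrite /GRing.scale/= !fctE mulNr mulrC.
apply: is_derive_eq; rewrite /GRing.scale/= !fctE/= subr0.
by rewrite -[GRing.scale]/( *%R); field.
Qed.

(* The derivative of (x - m)^k * pdf integrates to 0 over the line. *)
Lemma normal_moment_rec m s k : s != 0 -> (k < 4)%N ->
  \int[mu]_x ((x - m) ^+ k.+1 * normal_pdf m s x) =
  s ^+ 2 * k%:R * \int[mu]_x ((x - m) ^+ k.-1 * normal_pdf m s x).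
Proof.
move=> s0 k4.
(* For k = 0 the truncated predecessor is harmless, as the factor [k%:R] vanishes. *)
pose f x := k%:R * ((x - m) ^+ k.-1 * normal_pdf m s x)
            - s ^- 2 * ((x - m) ^+ k.+1 * normal_pdf m s x).
pose F x := (x - m) ^+ k * normal_pdf m s x.
have s2 : 0 < s ^+ 2 by rewrite exprn_even_gt0.
have i1 := integrable_normal_moment m s k.-1 s0 (leq_trans (leq_pred _) (ltnW k4)).
have i2 := integrable_normal_moment m s k.+1 s0 k4.
have dF x : is_derive x 1 F (f x).
  have dp := is_derive_normal_pdf m s x s0.
  have -> : F = ((id - cst m) ^+ k) * normal_pdf m s.
    by apply/funext => y; rewrite /F !fctE.
  apply: is_derive_eq; rewrite /GRing.scale/= !fctE/= /f subr0 (exprS (x - m) k).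
  by field.
have cf : continuous f.
  have cp : continuous (normal_pdf m s) by exact: continuous_normal_pdf.
  have cX j : continuous (fun x => (x - m) ^+ j).
    move=> x; apply: (cvg_comp (fun x => x - m) (fun x => x ^+ j)).
      by apply: cvgB; [exact: cvg_id|exact: cvg_cst].
    exact: exprn_continuous.
  by move=> x; apply: cvgB; (apply: cvgM; [exact: cvg_cst|]);
    apply: cvgM; [exact: cX|exact: cp|exact: cX|exact: cp].
have ifk : mu.-integrable setT (EFin \o f).
  by apply: integrable_EFinB; exact: integrable_EFinZ.
(* Since k < 4 and n >= 1, n^k is at most n^4 / n, and n^4 times the density is bounded by the
   fourth moment estimate. *)
have bnd (y : R) (n : nat) : (0 < n)%N -> `|y| = n%:R ->
    `|F (m + y)| <= 32 * s ^+ 4 * normal_peak s * n%:R^-1.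
  move=> n0 yn; have := normal_pdf_fourth_moment_le m s (m + y) s0.
  have n1 : 1 <= n%:R :> R by rewrite ler1n.
  rewrite /F addrAC subrr add0r normrM normrX yn (ger0_norm (normal_pdf_ge0 _ _ _)).
  have -> : y ^+ 4 = n%:R ^+ 4 by rewrite -yn -normrX ger0_norm// exprn_even_ge0.
  have p0 := normal_pdf_ge0 m s (m + y).
  have C0 : 0 <= 32 * s ^+ 4 * normal_peak s.
    apply: mulr_ge0 (normal_peak_ge0 _); apply: mulr_ge0 => //.
    exact: exprn_even_ge0.
  set E := expR _ => h.
  have E1 : E <= 1.
    rewrite /E -[leRHS]expR0 ler_expR oppr_le0 divr_ge0// divr_ge0 ?sqr_ge0//.
    by rewrite mulrn_wge0// sqr_ge0.
  rewrite ler_pdivlMr ?ltr0n//.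
  apply: le_trans (_ : n%:R ^+ 4 * normal_pdf m s (m + y) <= _).
    by rewrite mulrAC ler_wpM2r// -exprSr ler_weXn2l.
  by apply: le_trans h _; rewrite ler_piMr.
have vanish (y : nat -> R) : (forall n, `|y n| = n%:R) ->
    F (m + y n) @[n --> \oo] --> 0.
  move=> yn; apply/norm_cvg0P.
  apply: (@squeeze_cvgr _ _ _ _ (cst 0) (fun n => 32 * s ^+ 4 * normal_peak s * n%:R^-1)).
  - near=> n; rewrite normr_ge0/= bnd//.
    by near: n; exact: nbhs_infty_gt.
  - exact: cvg_cst.
  - rewrite -[X in _ --> X](mulr0 (32 * s ^+ 4 * normal_peak s)).
    apply: cvgM; first exact: cvg_cst.
    rewrite -cvg_shiftS.
    exact: cvg_harmonic.
have := integral_derivative_eq0 F f m dF cf ifk.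
have vp := vanish (fun n => n%:R) (fun n => ger0_norm (ler0n R n)).
have vm := vanish (fun n => - n%:R) (fun n => etrans (normrN _) (ger0_norm (ler0n R n))).
move=> /(_ vp vm) int0.
have : \int[mu]_x f x = 0 by rewrite /Rintegral int0.
rewrite RintegralB//; [|exact: integrable_EFinZ..].
rewrite !RintegralZl// => /eqP; rewrite subr_eq0 => /eqP e.
by rewrite -mulrA e mulrA divff ?mul1r// gt_eqF.
Unshelve. all: by end_near.
Qed.

End normal_moments.

(** * Passing from a random variable to its law *)

Section gaussian_law.
Context {R : realType}.
Implicit Types (m s : R).
Local Notation mu := (@lebesgue_measure R).

Lemma integrable_normal_prob m s (h : R -> R) : measurable_fun setT h ->
  mu.-integrable setT (EFin \o (fun x => h x * normal_pdf m s x)) ->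
  (normal_prob m s).-integrable setT (EFin \o h).
Proof.
move=> mh /integrableP[_ hp]; apply/integrableP; split; first exact/measurable_EFinP.
rewrite ge0_integral_normal_prob//; last first.
  by apply/measurable_EFinP; exact: measurableT_comp.
apply: le_lt_trans hp; rewrite le_eqVlt; apply/orP; left; apply/eqP.
apply: eq_integral => x _ /=.
by rewrite normrM (ger0_norm (normal_pdf_ge0 _ _ _)) EFinM.
Qed.

(** The nonnegative case handles the positive and negative parts separately; the density, being
    nonnegative, moves inside each of them. *)
Lemma Rintegral_normal_prob m s (h : R -> R) : measurable_fun setT h ->
  mu.-integrable setT (EFin \o (fun x => h x * normal_pdf m s x)) ->
  \int[normal_prob m s]_x h x = \int[mu]_x (h x * normal_pdf m s x).
Proof.
move=> mh hp; congr fine; rewrite integralE [RHS]integralE.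
rewrite !ge0_integral_normal_prob//; last 2 first.
- by apply: measurable_funeneg; exact/measurable_EFinP.
- by apply: measurable_funepos; exact/measurable_EFinP.
by congr (_ - _)%E; apply: eq_integral => x _ /=;
  rewrite ?funeposE ?funenegE -?EFinN -!EFin_max -EFinM maxr_pMl ?normal_pdf_ge0//
    ?mul0r ?mulNr.
Qed.

Context d d' (Omega : measurableType d) (T' : measurableType d') (P : probability Omega R).
Variables (Y : Omega -> T') (mY : measurable_fun setT Y).
Variables (nu : {measure set T' -> \bar R}) (h : T' -> R).
Hypothesis law : forall A : set T', measurable A -> P (Y @^-1` A) = nu A.
Hypothesis mh : measurable_fun setT h.
Hypothesis inth : nu.-integrable setT (EFin \o h).

(** The law [nu] is the pushforward of [P] by [Y]. It stays abstract so that both the Dirac and the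
    normal case of [gaussian_rv] are covered. *)
Lemma integrable_law : P.-integrable setT (EFin \o (fun w => h (Y w))).
Proof.
apply/integrableP; split; first by apply/measurable_EFinP; exact: measurableT_comp.
case/integrableP : inth => _; apply: le_lt_trans.
rewrite [leRHS](@eq_measure_integral _ _ _ _ (pushforward P Y)); last first.
  by move=> A mA _; rewrite -law.
rewrite ge0_integral_pushforward//.
by apply/measurable_EFinP; exact: measurableT_comp.
Qed.

Lemma Rintegral_law : \int[P]_w h (Y w) = \int[nu]_x h x.
Proof.
congr fine.
rewrite [RHS](@eq_measure_integral _ _ _ _ (pushforward P Y)); last first.
  by move=> A mA _; rewrite -law.
rewrite integral_pushforward//; first exact/measurable_EFinP.
exact: integrable_law.
Qed.

End gaussian_law.
Arguments Rintegral_law {R d d' Omega T' P Y} mY {nu h}.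
Arguments integrable_law {R d d' Omega T' P Y} mY {nu h}.

Section gaussian_moments.
Context {R : realType} {d} {Omega : measurableType d} {P : probability Omega R}.
Local Notation mu := (@lebesgue_measure R).

Lemma Rintegral_cst_prob (c : R) : \int[P]_w c = c.
Proof. by rewrite Rintegral_cst// [X in fine X](@probability_setT _ _ _ P) mulr1. Qed.

(** In the nondegenerate case the recursion with k = 3 and k = 1 gives fourth moment 3 s^4 and
    second moment s^2. In the degenerate case all positive moments about [m] vanish. *)
Lemma gaussian_rv_moments (Y : Omega -> R) : measurable_fun setT Y ->
  gaussian_rv P Y -> exists m : R,
  [/\ forall k, (k <= 4)%N -> P.-integrable setT (EFin \o (fun w => (Y w - m) ^+ k)),
      \int[P]_w (Y w - m) = 0 &
      \int[P]_w ((Y w - m) ^+ 4) = 3 * (\int[P]_w ((Y w - m) ^+ 2)) ^+ 2].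
Proof.
move=> mY [m [s lawY]]; exists m.
have mX k : measurable_fun setT (fun x : R => (x - m) ^+ k).
  by apply: measurable_funX; exact: measurable_funB.
have [s0|s0] := eqVneq s 0.
  have law (A : set R) : measurable A -> P (Y @^-1` A) = \d_m A.
    by move=> mA; rewrite lawY// s0 eqxx.
  have dX k : (\d_m : {measure set R -> \bar R}).-integrable setT
      (EFin \o (fun x : R => (x - m) ^+ k)).
    apply/integrableP; split; first exact/measurable_EFinP.
    rewrite integral_dirac//; last by apply/measurable_EFinP; exact: measurableT_comp.
    by rewrite diracT mul1e ltry.
  have E k : \int[P]_w (Y w - m) ^+ k = 0 ^+ k.
    rewrite (Rintegral_law mY law (mX k) (dX k)) /Rintegral integral_dirac//.
      by rewrite diracT mul1e/= subrr.
    exact/measurable_EFinP.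
  split => [k _||].
  - exact: (integrable_law mY law (mX k) (dX k)).
  - by have := E 1%N; rewrite expr1.
  - by rewrite !E !expr0n/= mulr0.
pose nu : {measure set (measurableTypeR R) -> \bar R} := normal_prob m s.
have law (A : set R) : measurable A -> P (Y @^-1` A) = nu A.
  by move=> mA; rewrite lawY// (negbTE s0).
have nX k : (k <= 4)%N -> nu.-integrable setT
    (EFin \o (fun x : R => (x - m) ^+ k)).
  by move=> k4; apply: integrable_normal_prob => //; exact: integrable_normal_moment.
have E k : (k <= 4)%N ->
    \int[P]_w (Y w - m) ^+ k = \int[mu]_x ((x - m) ^+ k * normal_pdf m s x).
  move=> k4; rewrite (Rintegral_law (T' := measurableTypeR R) mY law (mX k) (nX k k4)).
  by rewrite Rintegral_normal_prob//; exact: integrable_normal_moment.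
have N0 : \int[mu]_x ((x - m) ^+ 0 * normal_pdf m s x) = 1.
  rewrite /Rintegral; under eq_integral do rewrite expr0 mul1r.
  by rewrite integral_normal_pdf.
split => [k k4||].
- exact: (integrable_law (T' := measurableTypeR R) mY law (mX k) (nX k k4)).
- by have := E 1%N isT; rewrite normal_moment_rec// mulr0 mul0r.
- rewrite !E// (normal_moment_rec m s 3)// (normal_moment_rec m s 1)// N0.
  by ring.
Qed.

(** The location parameter of the law is the mean, hence 0. *)
Lemma centered_gaussian_moments (Y : Omega -> R) : measurable_fun setT Y ->
  gaussian_rv P Y -> \int[P]_w Y w = 0 ->
  [/\ forall k, (k <= 4)%N -> P.-integrable setT (EFin \o (fun w => Y w ^+ k)) &
      \int[P]_w (Y w ^+ 4) = 3 * (\int[P]_w (Y w ^+ 2)) ^+ 2].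
Proof.
move=> mY /gaussian_rv_moments-/(_ mY) [m [iY EY EY4]] Y0.
have ic (c : R) : P.-integrable setT (EFin \o (fun=> c)).
  exact: finite_measure_integrable_cst.
have m0 : m = 0.
  have iY1 : P.-integrable setT (EFin \o Y).
    have -> : Y = (fun w => (Y w - m) + m) by apply/funext => w; rewrite subrK.
    apply: integrable_EFinD => //; exact: iY 1%N isT.
  move: EY; rewrite RintegralB// Y0 Rintegral_cst_prob sub0r.
  by move/eqP; rewrite oppr_eq0 => /eqP.
have e k : (fun w => Y w ^+ k) = (fun w => (Y w - m) ^+ k).
  by apply/funext => w; rewrite m0 subr0.
by split=> [k k4|]; rewrite !e//; exact: iY.
Qed.

End gaussian_moments.

(** * Sums of squares of jointly Gaussian variables *)

Section gaussian_space.
Context {R : realType} {d} {Omega : measurableType d} {P : probability Omega R}.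
Implicit Types f g : Omega -> R.

(** A vector space of centered Gaussian variables. Closure under sums and scalings makes [f + g] and
    [f - g] Gaussian, which is how joint Gaussianity enters the moment computations. *)
Record gaussian_space (G : set (Omega -> R)) : Prop := {
  gaussian_spaceD : forall f g, G f -> G g -> G (fun w => f w + g w);
  gaussian_spaceZ : forall c f, G f -> G (fun w => c * f w);
  gaussian_space_measurable : forall f, G f -> measurable_fun setT f;
  gaussian_space_gaussian : forall f, G f -> gaussian_rv P f;
  gaussian_space_centered : forall f, G f -> \int[P]_w f w = 0 }.

Variables (G : set (Omega -> R)) (gG : gaussian_space G).

Let moments f : G f ->
  [/\ forall k, (k <= 4)%N -> P.-integrable setT (EFin \o (fun w => f w ^+ k)) &
      \int[P]_w (f w ^+ 4) = 3 * (\int[P]_w (f w ^+ 2)) ^+ 2].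
Proof.
move=> Gf; apply: centered_gaussian_moments.
- exact: (gaussian_space_measurable _ gG).
- exact: (gaussian_space_gaussian _ gG).
- exact: (gaussian_space_centered _ gG).
Qed.

Lemma gaussian_spaceB f g : G f -> G g -> G (fun w => f w - g w).
Proof.
move=> Gf Gg; have -> : (fun w => f w - g w) = (fun w => f w + -1 * g w).
  by apply/funext => w; rewrite mulN1r.
by apply: (gaussian_spaceD _ gG) => //; exact: (gaussian_spaceZ _ gG).
Qed.

Lemma gaussian_space_integrableX f k : G f -> (k <= 4)%N ->
  P.-integrable setT (EFin \o (fun w => f w ^+ k)).
Proof. by move=> /moments[+ _] k4; exact. Qed.

Lemma gaussian_space_integrableM f g : G f -> G g ->
  P.-integrable setT (EFin \o (fun w => f w * g w)).
Proof.
move=> Gf Gg.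
have -> : (fun w => f w * g w) =
    (fun w => 2^-1 * ((f w + g w) ^+ 2 - f w ^+ 2 - g w ^+ 2)).
  by apply/funext => w; field.
apply: integrable_EFinZ; apply: integrable_EFinB; last exact: gaussian_space_integrableX.
apply: integrable_EFinB; last exact: gaussian_space_integrableX.
by apply: (gaussian_space_integrableX (fun w => f w + g w) 2) => //; exact: (gaussian_spaceD _ gG).
Qed.

(** Reduces mixed moments of order four to fourth powers of single elements of the space. *)
Let polarization (a b : R) :
  a ^+ 2 * b ^+ 2 =
  12^-1 * ((a + b) ^+ 4 + (a - b) ^+ 4 - 2 * (a ^+ 4 + b ^+ 4)).
Proof. by field. Qed.

Lemma gaussian_space_integrable_sqrM f g : G f -> G g ->
  P.-integrable setT (EFin \o (fun w => f w ^+ 2 * g w ^+ 2)).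
Proof.
move=> Gf Gg; under eq_fun do rewrite /= polarization.
have i4 h : G h -> P.-integrable setT (EFin \o (fun w => h w ^+ 4)).
  by move=> Gh; exact: gaussian_space_integrableX.
apply: integrable_EFinZ; apply: integrable_EFinB.
  apply: integrable_EFinD; first exact: (i4 _ (gaussian_spaceD _ gG _ _ Gf Gg)).
  exact: (i4 _ (gaussian_spaceB _ _ Gf Gg)).
by apply: integrable_EFinZ; apply: integrable_EFinD; exact: i4.
Qed.

(** Wick's formula for E[f^2 g^2]: after polarization, each of f + g, f - g, f and g has fourth
    moment three times its squared variance. *)
Lemma Rintegral_gaussian_sqrM f g : G f -> G g ->
  \int[P]_w (f w ^+ 2 * g w ^+ 2) =
  (\int[P]_w (f w ^+ 2)) * (\int[P]_w (g w ^+ 2)) + 2 * (\int[P]_w (f w * g w)) ^+ 2.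
Proof.
move=> Gf Gg.
have i4 h : G h -> P.-integrable setT (EFin \o (fun w => h w ^+ 4)).
  by move=> Gh; exact: gaussian_space_integrableX.
have i2 h : G h -> P.-integrable setT (EFin \o (fun w => h w ^+ 2)).
  by move=> Gh; exact: gaussian_space_integrableX.
have GD := gaussian_spaceD _ gG _ _ Gf Gg.
have GB := gaussian_spaceB _ _ Gf Gg.
have ifg := gaussian_space_integrableM _ _ Gf Gg.
have s2D : \int[P]_w ((f w + g w) ^+ 2) =
    \int[P]_w (f w ^+ 2) + \int[P]_w (g w ^+ 2) + 2 * \int[P]_w (f w * g w).
  have e : (fun w => (f w + g w) ^+ 2) = (fun w => f w ^+ 2 + g w ^+ 2 + 2 * (f w * g w)).
    by apply/funext => w; ring.
  rewrite e RintegralD ?RintegralD ?RintegralZl//; try exact: i2.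
    by apply: integrable_EFinD; exact: i2.
  exact: integrable_EFinZ.
have s2B : \int[P]_w ((f w - g w) ^+ 2) =
    \int[P]_w (f w ^+ 2) + \int[P]_w (g w ^+ 2) - 2 * \int[P]_w (f w * g w).
  have e : (fun w => (f w - g w) ^+ 2) = (fun w => f w ^+ 2 + g w ^+ 2 - 2 * (f w * g w)).
    by apply/funext => w; ring.
  rewrite e RintegralB ?RintegralD ?RintegralZl//; try exact: i2.
    by apply: integrable_EFinD; exact: i2.
  exact: integrable_EFinZ.
under eq_Rintegral do rewrite polarization.
rewrite RintegralZl//; last first.
  apply: integrable_EFinB; last by apply: integrable_EFinZ; apply: integrable_EFinD; exact: i4.
  by apply: integrable_EFinD; [exact: i4 GD|exact: i4 GB].
rewrite RintegralB//; last 2 first.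
- by apply: integrable_EFinD; [exact: i4 GD|exact: i4 GB].
- by apply: integrable_EFinZ; apply: integrable_EFinD; exact: i4.
rewrite RintegralD//; [|exact: i4 GD|exact: i4 GB].
rewrite RintegralZl//; last by apply: integrable_EFinD; exact: i4.
rewrite RintegralD//; [|exact: i4|exact: i4].
have [_ ->] := moments _ GD; have [_ ->] := moments _ GB.
have [_ ->] := moments _ Gf; have [_ ->] := moments _ Gg.
by rewrite s2D s2B; field.
Qed.

Lemma gaussian_chebyshev n (Y : nat -> Omega -> R) (e : R) : 0 < e ->
  (forall k, G (Y k)) ->
  (P [set w | e <= `|\sum_(k < n) Y k w ^+ 2 - \sum_(k < n) \int[P]_w (Y k w ^+ 2)| ]%R
   <= (2 * (\sum_(j < n) \sum_(k < n) (\int[P]_w (Y j w * Y k w)) ^+ 2) / e ^+ 2)%:E)%E.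
Proof.
move=> e0 GY.
pose S w := \sum_(k < n) Y k w ^+ 2.
pose m := \sum_(k < n) \int[P]_w (Y k w ^+ 2).
have iY k : P.-integrable setT (EFin \o (fun w => Y k w ^+ 2)).
  exact: gaussian_space_integrableX.
have iYY j k := gaussian_space_integrable_sqrM _ _ (GY j) (GY k).
have iS : P.-integrable setT (EFin \o S) by apply: integrable_EFin_sum.
have ES : \int[P]_w S w = m by rewrite /S Rintegral_sum.
have S2E w : S w ^+ 2 = \sum_(j < n) \sum_(k < n) (Y j w ^+ 2 * Y k w ^+ 2).
  by rewrite expr2 /S mulr_suml; apply: eq_bigr => j _; rewrite mulr_sumr.
have iS2 : P.-integrable setT (EFin \o (fun w => S w ^+ 2)).
  rewrite (funext S2E).
  by apply: integrable_EFin_sum => j; apply: integrable_EFin_sum => k.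
(* Summing Wick's formula over all pairs, the products of variances add up to m^2, so the variance
   of [S] is twice the sum of the squared covariances. *)
have ES2 : \int[P]_w (S w ^+ 2) =
    m ^+ 2 + 2 * \sum_(j < n) \sum_(k < n) (\int[P]_w (Y j w * Y k w)) ^+ 2.
  under eq_Rintegral do rewrite S2E.
  rewrite Rintegral_sum; last by move=> j; exact: integrable_EFin_sum.
  rewrite expr2 /m mulr_suml mulr_sumr -big_split/=; apply: eq_bigr => j _.
  rewrite Rintegral_sum// mulr_sumr mulr_sumr -big_split/=; apply: eq_bigr => k _.
  by rewrite Rintegral_gaussian_sqrM.
have ic (c : R) : P.-integrable setT (EFin \o (fun=> c)).
  exact: finite_measure_integrable_cst.
have ZE w : (S w - m) ^+ 2 = S w ^+ 2 - (2 * m) * S w + m ^+ 2 by ring.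
have iZ : P.-integrable setT (EFin \o (fun w => (S w - m) ^+ 2)).
  rewrite (funext ZE).
  apply: integrable_EFinD => //.
  by apply: integrable_EFinB => //; exact: integrable_EFinZ.
have EZ : \int[P]_w ((S w - m) ^+ 2) =
    2 * \sum_(j < n) \sum_(k < n) (\int[P]_w (Y j w * Y k w)) ^+ 2.
  under eq_Rintegral do rewrite ZE.
  rewrite RintegralD//; last by apply: integrable_EFinB => //; exact: integrable_EFinZ.
  rewrite RintegralB//; last exact: integrable_EFinZ.
  rewrite RintegralZl// Rintegral_cst_prob ES ES2.
  by ring.
have mZ : measurable_fun setT (fun w => S w - m).
  by apply: measurable_funB => //; have /integrableP[/measurable_EFinP] := iS.
pose X : {RV P >-> R} := MeasurableFun.Pack (MeasurableFun.Class
  (isMeasurableFun.Build _ _ _ _ _ mZ)).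
have := @markov _ _ _ P X (fun x => x ^+ 2) e e0.
rewrite -EZ EFinM lee_pdivlMr ?exprn_gt0// muleC.
have -> : ('E_P[(fun x => x ^+ 2)%R \o (fun x => `|x|)%R \o X])%E =
    (\int[P]_w ((S w - m) ^+ 2))%:E.
  rewrite unlock fineK ?integrable_fin_num//; apply: eq_integral => w _ /=.
  by rewrite real_normK// num_real.
apply=> //; first by move=> r _; exact: sqr_ge0.
by move=> x y; rewrite !nnegrE => x0 y0; rewrite ler_sqr.
Qed.

End gaussian_space.
Arguments gaussian_space {R d Omega} P G.

(** * Variations of fractional Brownian motion *)

Section fbm_gaussian.
Context {R : realType} {d} {Omega : measurableType d} {P : probability Omega R}.
Variables (H : R) (B : R -> {RV P >-> R}).
Hypothesis fbmB : fractional_brownian_motion H B.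

(** The linear combinations on which [gaussian_process] imposes Gaussianity; grid increments and
    second differences of [B] lie in this span. *)
Definition process_span : set (Omega -> R) :=
  [set Y | exists n (t c : 'I_n -> R),
     (forall i, 0 <= t i) /\ Y = fun w => \sum_(i < n) c i * B (t i) w].

(** Integrability comes from the Gaussian law, since a vanishing expectation alone does not give
    it. *)
Lemma fbm_integrable t : 0 <= t -> P.-integrable setT (EFin \o B t).
Proof.
case: fbmB => gB _ _ _ t0.
have gt : gaussian_rv P (B t).
  have := gB 1%N (fun=> t) (fun=> 1) (fun=> t0).
  by under eq_fun do rewrite big_ord1 mul1r.
have [m [iB _ _]] := gaussian_rv_moments _ (measurable_funPT (B t)) gt.
have -> : (B t : Omega -> R) = (fun w => (B t w - m) + m).
  by apply/funext => w; rewrite subrK.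
apply: integrable_EFinD; first exact: iB 1%N isT.
exact: finite_measure_integrable_cst.
Qed.

Lemma fbm_gaussian_space : gaussian_space P process_span.
Proof.
split.
- move=> _ _ [n [t [c [t0 ->]]]] [m [s [e [s0 ->]]]].
  (* The two families of times and coefficients are concatenated. *)
  exists (n + m)%N, (fun i => match fintype.split i with inl j => t j | inr j => s j end),
    (fun i => match fintype.split i with inl j => c j | inr j => e j end); split.
    by move=> i; case: fintype.split.
  apply/funext => w; rewrite big_split_ord/=; congr (_ + _); apply: eq_bigr => i _.
    by rewrite (unsplitK (inl i)).
  by rewrite (unsplitK (inr i)).
- move=> a _ [n [t [c [t0 ->]]]]; exists n, t, (fun i => a * c i); split=> //.
  by apply/funext => w; rewrite mulr_sumr; apply: eq_bigr => i _; rewrite mulrA.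
- move=> _ [n [t [c [t0 ->]]]].
  apply: measurable_sum => i; apply: measurable_funM => //.
- by move=> _ [n [t [c [t0 ->]]]]; case: fbmB => gB _ _ _; exact: gB.
- move=> _ [n [t [c [t0 ->]]]].
  rewrite Rintegral_sum; last by move=> i; apply: integrable_EFinZ; exact: fbm_integrable.
  rewrite big1// => i _; rewrite RintegralZl//; last exact: fbm_integrable.
  case: fbmB => _ /(_ _ (t0 i)) + _ _; rewrite expectation_def => e.
  by rewrite /Rintegral e mulr0.
Qed.

Lemma process_span1 t : 0 <= t -> process_span (B t).
Proof.
move=> t0; exists 1%N, (fun=> t), (fun=> 1); split => //.
by apply/funext => w; rewrite big_ord1 mul1r.
Qed.

Lemma fbm_cov t s : 0 <= t -> 0 <= s -> \int[P]_w (B t w * B s w) =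
  2^-1 * (t `^ (2 * H) + s `^ (2 * H) - `|t - s| `^ (2 * H)).
Proof.
move=> t0 s0; case: fbmB => _ _ /(_ t s t0 s0) + _.
by rewrite unlock /Rintegral => ->.
Qed.

(** The powers of single times cancel in the four covariances, leaving only powers of differences:
    the increments are stationary. *)
Lemma fbm_incr_cov t s t' s' : 0 <= t -> 0 <= s -> 0 <= t' -> 0 <= s' ->
  \int[P]_w ((B t w - B s w) * (B t' w - B s' w)) =
  2^-1 * (`|t - s'| `^ (2 * H) + `|s - t'| `^ (2 * H)
          - `|t - t'| `^ (2 * H) - `|s - s'| `^ (2 * H)).
Proof.
move=> t0 s0 t'0 s'0.
have iM x y : 0 <= x -> 0 <= y -> P.-integrable setT (EFin \o (fun w => B x w * B y w)).
  move=> x0 y0; by apply: (gaussian_space_integrableM _ fbm_gaussian_space);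
    exact: process_span1.
have e w : (B t w - B s w) * (B t' w - B s' w) =
    (B t w * B t' w + B s w * B s' w) - (B t w * B s' w + B s w * B t' w) by ring.
under eq_Rintegral do rewrite e.
rewrite RintegralB//; [|by apply: integrable_EFinD; exact: iM..].
rewrite !RintegralD//; try exact: iM.
by rewrite !fbm_cov//; ring.
Qed.

End fbm_gaussian.

(** * Concavity of powers and sums of squared matrix entries *)

Section real_lemmas.
Context {R : realType}.

(** Convexity of the power 1/p >= 1 at the midpoint of a^p and b^p, followed by the increasing power
    p. *)
Lemma powR_midpoint_concave (p a b : R) : 0 < p <= 1 -> 0 <= a -> 0 <= b ->
  a `^ p + b `^ p <= 2 * ((a + b) / 2) `^ p.
Proof.
move=> /andP[p0 p1] a0 b0.
have r1 : 1 <= p^-1 by rewrite invf_ge1.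
have e (c : R) : 0 <= c -> (c `^ p) `^ p^-1 = c.
  by move=> c0; rewrite -powRrM divff ?gt_eqF// powRr1.
have := @convex_powR R p^-1 r1 (Itv01 (_ : 0 <= 2^-1) (_ : 2^-1 <= 1)) (a `^ p) (b `^ p).
rewrite !inE/= !in_itv/= !powR_ge0/= => /(_ _ _ isT isT).
have h0 : 0 <= 2^-1 :> R by [].
have h1 : 2^-1 <= 1 :> R by rewrite invf_le1 ?ler1n.
move=> /(_ h0 h1); rewrite convRE [X in X `^ _ <= _]convRE/= !e//.
have -> : unstable.onem (2^-1 : R) = 2^-1 by rewrite /unstable.onem; field.
move=> /(@ge0_ler_powR R p (ltW p0) _ _ _ _).
rewrite !nnegrE powR_ge0 -powRrM mulVf ?gt_eqF// powRr1; last first.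
  by rewrite addr_ge0// mulr_ge0// powR_ge0.
have -> : 2^-1 * a + 2^-1 * b = (a + b) / 2 by field.
by move=> /(_ isT); rewrite divr_ge0 ?addr_ge0// => /(_ isT); lra.
Qed.

(* |c j k| is -c j k off the diagonal, so the sum of the |c j k| is at most
   twice the sum of the diagonal entries. *)
Lemma sum_sqr_le_of_nonpos n (c : nat -> nat -> R) (q : R) :
  (forall k, c k k = q) -> (forall j k, j != k -> c j k <= 0) ->
  (forall j k, `|c j k| <= q) -> 0 <= \sum_(j < n) \sum_(k < n) c j k ->
  \sum_(j < n) \sum_(k < n) c j k ^+ 2 <= 2 * n%:R * q ^+ 2.
Proof.
move=> cd co cq c0.
have q0 : 0 <= q by apply: le_trans (cq 0 0)%N.
(* One factor [|c j k|] of the square is bounded by [q]; the other equals [2 * q - c j k] on the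
   diagonal and [- c j k] off it. *)
apply: (@le_trans _ _ (\sum_(j < n) \sum_(k < n) (q * ((j == k)%:R * (2 * q)) - q * c j k))).
  apply: ler_sum => j _; apply: ler_sum => k _.
  rewrite -mulrBr -real_normK ?num_real// expr2 ler_pM//.
  have [->|jk] := eqVneq j k; first by rewrite cd ger0_norm// mul1r; lra.
  by rewrite mul0r sub0r ler0_norm// co.
under eq_bigr do rewrite sumrB -!mulr_sumr.
rewrite sumrB -!mulr_sumr.
under eq_bigr => j _.
  rewrite (bigD1 j)//= eqxx mul1r big1 ?addr0; last first.
    by move=> k /negbTE kj; rewrite eq_sym kj mul0r.
  over.
rewrite sumr_const card_ord -[_ *+ n]mulr_natr.
have -> : 2 * n%:R * q ^+ 2 = q * (2 * q * n%:R) by ring.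
by rewrite lerBlDr lerDl mulr_ge0.
Qed.

(** The summands are covariances of second differences when [c] is the covariance matrix of
    increments. A signed sum of four terms has square at most 4 times the sum of their squares, and
    each of the four shifted blocks lies in the full n by n array; hence 16. *)
Lemma sum_sqr_diff2_le n (c : nat -> nat -> R) :
  \sum_(j < n.-1) \sum_(k < n.-1)
    (c j.+1 k.+1 + c j k - (c j.+1 k + c j k.+1)) ^+ 2 <=
  16 * \sum_(j < n) \sum_(k < n) c j k ^+ 2.
Proof.
case: n => [|n]; first by rewrite !big_ord0 mulr0.
rewrite /=.
have up (F : nat -> R) : (forall k, 0 <= F k) -> \sum_(k < n) F k <= \sum_(k < n.+1) F k.
  by move=> F0; rewrite big_ord_recr/= lerDl.
have sh (F : nat -> R) : (forall k, 0 <= F k) -> \sum_(k < n) F k.+1 <= \sum_(k < n.+1) F k.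
  by move=> F0; rewrite big_ord_recl/= lerDr.
have s0 (F : nat -> R) m : (forall k, 0 <= F k) -> 0 <= \sum_(k < m) F k.
  by move=> F0; exact: sumr_ge0.
have c0 j k : 0 <= c j k ^+ 2 by exact: sqr_ge0.
set M := \sum_(j < n.+1) _.
have h1 : \sum_(j < n) \sum_(k < n) c j.+1 k.+1 ^+ 2 <= M.
  apply: le_trans (sh (fun j => \sum_(k < n.+1) c j k ^+ 2) _); last by move=> j; exact: s0 (c0 j).
  by apply: ler_sum => j _; exact: (sh (fun k => c j.+1 k ^+ 2) (c0 _)).
have h2 : \sum_(j < n) \sum_(k < n) c j k ^+ 2 <= M.
  apply: le_trans (up (fun j => \sum_(k < n.+1) c j k ^+ 2) _); last by move=> j; exact: s0 (c0 j).
  by apply: ler_sum => j _; exact: (up (fun k => c j k ^+ 2) (c0 _)).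
have h3 : \sum_(j < n) \sum_(k < n) c j.+1 k ^+ 2 <= M.
  apply: le_trans (sh (fun j => \sum_(k < n.+1) c j k ^+ 2) _); last by move=> j; exact: s0 (c0 j).
  by apply: ler_sum => j _; exact: (up (fun k => c j.+1 k ^+ 2) (c0 _)).
have h4 : \sum_(j < n) \sum_(k < n) c j k.+1 ^+ 2 <= M.
  apply: le_trans (up (fun j => \sum_(k < n.+1) c j k ^+ 2) _); last by move=> j; exact: s0 (c0 j).
  by apply: ler_sum => j _; exact: (sh (fun k => c j k ^+ 2) (c0 _)).
apply: (@le_trans _ _ (\sum_(j < n) \sum_(k < n)
   (4 * (c j.+1 k.+1 ^+ 2 + c j k ^+ 2 + (c j.+1 k ^+ 2 + c j k.+1 ^+ 2))))).
  apply: ler_sum => j _; apply: ler_sum => k _.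
  move: (c j.+1 k.+1) (c j k) (c j.+1 k) (c j k.+1) => x y z t.
  have -> : 4 * (x ^+ 2 + y ^+ 2 + (z ^+ 2 + t ^+ 2)) = (x + y - (z + t)) ^+ 2
    + ((x - y) ^+ 2 + (x + z) ^+ 2 + (x + t) ^+ 2
       + (y + z) ^+ 2 + (y + t) ^+ 2 + (z - t) ^+ 2) by ring.
  by rewrite lerDl !addr_ge0 ?sqr_ge0.
under eq_bigr do rewrite -mulr_sumr !big_split/=.
rewrite -mulr_sumr !big_split/=; lra.
Qed.

End real_lemmas.

(** * Covariances of the grid increments and concentration of both variations *)

Section fbm_variations.
Context {R : realType} {d} {Omega : measurableType d} {P : probability Omega R}.
Variables (H T : R) (B : R -> {RV P >-> R}).
Hypotheses (H_gt0 : 0 < H) (H_lt : H < 2^-1) (T_gt0 : 0 < T).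
Hypothesis fbmB : fractional_brownian_motion H B.
Variable n : nat.
Hypothesis n_gt0 : (0 < n)%N.

Let p := 2 * H.
Let h := T / n%:R.
Let q := h `^ p.
Let xi k w := B (grid T n k.+1) w - B (grid T n k) w.
Let c j k := \int[P]_w (xi j w * xi k w).

Let h_gt0 : 0 < h. Proof. by rewrite divr_gt0// ltr0n. Qed.

Let p_gt0 : 0 < p. Proof. exact: mulr_gt0. Qed.

Let grid_ge0 k : 0 <= grid T n k.
Proof. by rewrite /grid !mulr_ge0// ?invr_ge0// ltW. Qed.

Let gridE k : grid T n k = k%:R * h. Proof. by rewrite /grid mulrA. Qed.

Let gridS k : grid T n k.+1 = grid T n k + h.
Proof. by rewrite !gridE -natr1 mulrDl mul1r. Qed.

(** Half a central second difference of the function |y|^p at the lag, so that concavity decides its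
    sign. *)
Let cE j k : c j k = 2^-1 * (`|grid T n j - grid T n k + h| `^ p
    + `|grid T n j - grid T n k - h| `^ p - 2 * `|grid T n j - grid T n k| `^ p).
Proof.
rewrite /c (fbm_incr_cov _ _ fbmB)// -/p !gridS.
rewrite (_ : grid T n j + h - (grid T n k + h) = grid T n j - grid T n k); last by ring.
rewrite (_ : grid T n j + h - grid T n k = grid T n j - grid T n k + h); last by ring.
rewrite (_ : grid T n j - (grid T n k + h) = grid T n j - grid T n k - h); last by ring.
by ring.
Qed.

Let c_diag k : c k k = q.
Proof.
rewrite cE subrr add0r sub0r normrN normr0 powR0 ?gt_eqF//.
by rewrite gtr0_norm// -/q; field.
Qed.

Let c_sym j k : c j k = c k j.
Proof. by apply: eq_Rintegral => w _; rewrite mulrC. Qed.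

(** By symmetry k < j. The lag is then at least [h], so y - h, y and y + h all lie in the half-line
    where the power p <= 1 is concave. *)
Let c_le0 j k : j != k -> c j k <= 0.
Proof.
wlog jk : j k / (k < j)%N => [wl|_].
  by rewrite neq_ltn => /orP[kj|kj]; [rewrite c_sym|]; rewrite wl// gtn_eqF.
rewrite cE; set y := grid T n j - grid T n k.
have hy : h <= y.
  rewrite /y !gridE -mulrBl -natrB ?(ltnW jk)// ler_peMl ?(ltW h_gt0)//.
  by rewrite ler1n subn_gt0.
have y0 : 0 <= y by apply: le_trans hy; exact: ltW.
rewrite (ger0_norm y0) !ger0_norm ?subr_ge0//; last by rewrite addr_ge0// ltW.
have p01 : 0 < p <= 1.
  by rewrite p_gt0/= /p -ler_pdivlMl// mulr1 ltW.
have := powR_midpoint_concave p (y + h) (y - h) p01.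
rewrite addr_ge0 ?(ltW h_gt0)// subr_ge0 => /(_ isT hy).
have -> : (y + h + (y - h)) / 2 = y by field.
lra.
Qed.

Let GG := fbm_gaussian_space _ _ fbmB.

Let span_xi k : process_span B (xi k).
Proof. by apply: (gaussian_spaceB _ GG); exact: process_span1. Qed.

Let sum_cov_ge0 : 0 <= \sum_(j < n) \sum_(k < n) c j k.
Proof.
suff -> : \sum_(j < n) \sum_(k < n) c j k = \int[P]_w ((\sum_(j < n) xi j w) ^+ 2).
  by apply: Rintegral_ge0 => w _; exact: sqr_ge0.
have e w : (\sum_(j < n) xi j w) ^+ 2 = \sum_(j < n) \sum_(k < n) (xi j w * xi k w).
  by rewrite expr2 mulr_suml; apply: eq_bigr => j _; rewrite mulr_sumr.
under eq_Rintegral do rewrite e.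
have iM j k := gaussian_space_integrableM _ GG _ _ (span_xi j) (span_xi k).
rewrite Rintegral_sum => [|j]; last exact: integrable_EFin_sum.
by apply: eq_bigr => j _; rewrite Rintegral_sum.
Qed.

(** Off the diagonal the covariance is nonpositive, and nonnegativity of the second moment of
    [xi j + xi k] gives [- c j k <= q]. *)
Let c_le j k : `|c j k| <= q.
Proof.
have [->|jk] := eqVneq j k; first by rewrite c_diag ger0_norm// powR_ge0.
rewrite ler0_norm ?c_le0// lerNl.
have iM i l := gaussian_space_integrableM _ GG _ _ (span_xi i) (span_xi l).
have : 0 <= \int[P]_w ((xi j w + xi k w) ^+ 2).
  by apply: Rintegral_ge0 => w _; exact: sqr_ge0.
have e w : (xi j w + xi k w) ^+ 2 =
    xi j w * xi j w + xi k w * xi k w + 2 * (xi j w * xi k w) by ring.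
under eq_Rintegral do rewrite e.
rewrite RintegralD//; [|exact: integrable_EFinD|exact: integrable_EFinZ].
rewrite RintegralD// RintegralZl// -!/(c _ _) !c_diag; lra.
Qed.

Let sum_cov2_le : \sum_(j < n) \sum_(k < n) c j k ^+ 2 <= 2 * n%:R * q ^+ 2.
Proof. exact: sum_sqr_le_of_nonpos. Qed.

Let q_gt0 : 0 < q. Proof. exact: powR_gt0. Qed.
Let n0 : 0 < n%:R :> R. Proof. by rewrite ltr0n. Qed.

(** The constant 4 is the 2 of [gaussian_chebyshev] times the 2 of [sum_cov2_le]; dividing by (e n
    q)^2 leaves one factor 1/n. *)
Lemma V12_fbm_deviation (e : R) : 0 < e ->
  (P [set w | e * (n%:R * q) <= `|V12 T n (fun t => B t w) - n%:R * q| ]%R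
   <= (4 / e ^+ 2 / n%:R)%:E)%E.
Proof.
move=> e0; have enq : 0 < e * (n%:R * q) by rewrite !mulr_gt0.
have := gaussian_chebyshev _ GG n xi _ enq span_xi.
have -> : \sum_(k < n) \int[P]_w (xi k w ^+ 2) = n%:R * q.
  under eq_bigr => k _.
    under eq_Rintegral do rewrite expr2.
    rewrite -/(c k k) c_diag; over.
  by rewrite sumr_const card_ord mulr_natl.
move=> /le_trans; apply; rewrite lee_fin ler_pdivrMr ?exprn_gt0//.
have -> : 4 / e ^+ 2 / n%:R * (e * (n%:R * q)) ^+ 2 = 2 * (2 * n%:R * q ^+ 2).
  by field; rewrite !gt_eqF.
by rewrite ler_pM2l.
Qed.

(** As for [V12], with the extra factor 16 of [sum_sqr_diff2_le]. *)
Lemma V22_fbm_deviation (e : R) : 0 < e ->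
  (P [set w | e * (n%:R * q) <=
       `|V22 T n (fun t => B t w) - n.-1%:R * (q * (4 - 2 `^ p))| ]%R
   <= (64 / e ^+ 2 / n%:R)%:E)%E.
Proof.
move=> e0; have enq : 0 < e * (n%:R * q) by rewrite !mulr_gt0.
pose zeta k w := xi k.+1 w - xi k w.
have Gz k : process_span B (zeta k) by exact: (gaussian_spaceB _ GG).
have covz j k : \int[P]_w (zeta j w * zeta k w) =
    c j.+1 k.+1 + c j k - (c j.+1 k + c j k.+1).
  have iM i l := gaussian_space_integrableM _ GG _ _ (span_xi i) (span_xi l).
  have e' w : zeta j w * zeta k w = (xi j.+1 w * xi k.+1 w + xi j w * xi k w)
     - (xi j.+1 w * xi k w + xi j w * xi k.+1 w) by rewrite /zeta; ring.
  under eq_Rintegral do rewrite e'.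
  by rewrite RintegralB ?RintegralD//; exact: integrable_EFinD.
have := gaussian_chebyshev _ GG n.-1 zeta _ enq Gz.
have -> : \sum_(k < n.-1) \int[P]_w (zeta k w ^+ 2) = n.-1%:R * (q * (4 - 2 `^ p)).
  (* Covariance of adjacent increments; the variance of a second difference is 2 q minus twice this
     value, that is q (4 - 2^p). *)
  have cS k : c k.+1 k = q * (2 `^ p / 2 - 1).
    rewrite cE (_ : grid T n k.+1 - grid T n k = h); last by rewrite gridS; ring.
    rewrite subrr normr0 powR0 ?gt_eqF// (gtr0_norm h_gt0).
    rewrite gtr0_norm ?addr_gt0// -/q.
    have -> : (h + h) `^ p = 2 `^ p * q.
      by rewrite -powRM ?(ltW h_gt0)//; congr (_ `^ _); ring.
    by field.
  under eq_bigr => k _.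
    under eq_Rintegral do rewrite expr2.
    rewrite covz !c_diag (c_sym k k.+1) !cS.
    rewrite (_ : q + q - _ = q * (4 - 2 `^ p)); last by field.
    over.
  by rewrite sumr_const card_ord mulr_natl.
have VE w : V22 T n (fun t => B t w) = \sum_(k < n.-1) zeta k w ^+ 2.
  by apply: eq_bigr => k _; rewrite /zeta /xi; congr (_ ^+ 2); ring.
under eq_set do rewrite -VE.
move=> /le_trans; apply; rewrite lee_fin ler_pdivrMr ?exprn_gt0//.
have -> : 64 / e ^+ 2 / n%:R * (e * (n%:R * q)) ^+ 2 = 2 * (16 * (2 * n%:R * q ^+ 2)).
  by field; rewrite !gt_eqF.
rewrite ler_pM2l//.
apply: (@le_trans _ _ (16 * \sum_(j < n) \sum_(k < n) c j k ^+ 2)).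
  apply: le_trans (sum_sqr_diff2_le n c).
  by under eq_bigr do under eq_bigr do rewrite covz.
by rewrite ler_pM2l.
Qed.

End fbm_variations.

(** * The drift along a path *)

Lemma locally_hoelder_bounded {R : realType} (lambda T : R) (b : R -> R) :
  0 < lambda -> 0 < T -> locally_hoelder lambda b ->
  exists M, forall t, 0 <= t <= T -> `|b t| <= M.
Proof.
move=> l0 T0 /(_ T T0) [C hC]; exists (`|C| * T `^ lambda + `|b 0|) => t t0T.
have /andP[t0 tT] := t0T.
have := hC 0 t; rewrite lexx (ltW T0) => /(_ isT t0T); rewrite subr0 => h.
rewrite -lerBlDr; apply: le_trans (lerB_dist _ _) _; apply: le_trans h _.
rewrite (@le_trans _ _ (`|C| * `|t| `^ lambda))//.
  by rewrite ler_wpM2r ?powR_ge0// ler_norm.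
by rewrite ler_wpM2l// ge0_ler_powR ?nnegrE ?(ltW l0) ?(ltW T0)// ger0_norm.
Qed.

Lemma bounded_itv_lty {R : realType} (b0 b1 : bool) (s t : R) :
  (lebesgue_measure [set` Interval (BSide b0 s) (BSide b1 t)] < +oo)%E.
Proof. by rewrite lebesgue_measure_itv/=; case: ifPn => // _; rewrite -EFinD ltry. Qed.

Section drift.
Context {R : realType}.
Variables (x0 a sigma eps : R) (b x : R -> R).
Hypotheses (a_gt0 : 0 < a) (eps_gt0 : 0 < eps).
Hypothesis solx : regularized_solution x0 a sigma eps b x.
Local Notation mu := (@lebesgue_measure R).

Let f s := a / (x s * (0 < x s)%R%:R + eps).

Definition drift t := \int[mu]_(s in `[0, t]) f s.

Let maxE s : x s * (0 < x s)%R%:R = Num.max (x s) 0.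
Proof.
by have [h|h] := ltP 0 (x s); rewrite ?mulr1 ?mulr0.
Qed.

Let den_ge s : eps <= x s * (0 < x s)%R%:R + eps.
Proof. by rewrite lerDr maxE le_max lexx orbT. Qed.

Let f_ge0 s : 0 <= f s.
Proof. by rewrite divr_ge0 ?(ltW a_gt0)// (le_trans (ltW eps_gt0)). Qed.

(** This bound blows up with [eps] and serves only for integrability; [f_le1] is the one uniform in
    [eps]. *)
Let f_le s : f s <= a / eps.
Proof.
rewrite ler_wpM2l ?(ltW a_gt0)// lef_pV2// posrE//.
exact: lt_le_trans (den_ge s).
Qed.

Let f_le1 s : 1 < x s -> f s <= a.
Proof.
move=> x1; rewrite /f ler_pdivrMr ?(lt_le_trans eps_gt0 (den_ge s))// ler_peMr ?(ltW a_gt0)//.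
by rewrite (lt_trans ltr01 x1) mulr1; move: eps_gt0 x1; lra.
Qed.

Let mf (t : R) : measurable_fun `[0, t] f.
Proof.
(* The inverse is written as a real power, which agrees with it on nonnegative arguments and is
   measurable everywhere. *)
have -> : f = (fun s => a * (Num.max (x s) 0 + eps) `^ (-1)).
  apply/funext => s; rewrite /f maxE powR_inv1// addr_ge0 ?(ltW eps_gt0)//.
  by rewrite le_max lexx orbT.
apply: measurable_funM => //.
apply: (measurableT_comp (f := @powR R ^~ (-1)) (measurable_powR (-1))).
apply: measurable_funD => //; apply: measurable_maxr => //.
apply: subspace_continuous_measurable_fun => //.
apply: continuous_subspaceW (proj1 solx) => s /=.
by rewrite !in_itv/= andbT => /andP[].
Qed.

Let intf (t : R) : mu.-integrable `[0, t] (EFin \o f).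
Proof.
apply: measurable_bounded_integrable => //.
  exact: bounded_itv_lty.
  exact: mf.
exists (a / eps); split; first exact: num_real.
by move=> M aM s _ /=; rewrite ger0_norm// (le_trans (f_le s))// ltW.
Qed.

Let driftB s t : 0 <= s <= t -> drift t - drift s = \int[mu]_(u in `]s, t]) f u.
Proof.
by move=> /andP[s0 st]; rewrite /drift Rintegral_itvB ?bnd_simp.
Qed.

Lemma le_drift s t : 0 <= s <= t -> drift s <= drift t.
Proof.
by move=> /driftB e; rewrite -subr_ge0 e; apply: Rintegral_ge0.
Qed.

Lemma drift0 : drift 0 = 0.
Proof. by rewrite /drift set_itv1 Rintegral_set1. Qed.

Let driftB_le s t : 0 <= s <= t -> (forall u, s < u <= t -> 1 < x u) ->
  drift t - drift s <= a * (t - s).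
Proof.
move=> st0 x1; rewrite driftB//; have /andP[s0 st] := st0.
apply: (@le_trans _ _ (\int[mu]_(u in `]s, t]) a)).
  apply: le_Rintegral => //.
  - apply: (integrableS _ _ _ (intf t)) => // u /=; rewrite !in_itv/= => /andP[su ->].
    by rewrite (le_trans s0 (ltW su)).
  - apply: measurable_bounded_integrable => //.
      exact: bounded_itv_lty.
    exists a; split; first exact: num_real.
    by move=> M aM u _ /=; rewrite ger0_norm ltW.
  - by move=> u /=; rewrite in_itv/= => h; apply: f_le1; exact: x1.
rewrite Rintegral_cst// [X in fine X]lebesgue_measure_itv/= lte_fin.
case: ltP => [_|ts]; first by rewrite -EFinD.
by rewrite mulr0 mulr_ge0 ?(ltW a_gt0)// subr_ge0.
Qed.

Lemma driftE t : 0 <= t -> x t = x0 + drift t + sigma * b t.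
Proof. exact: (proj2 solx). Qed.

(* After the last time the solution is at most 1 the drift coefficient is at
   most a, uniformly in eps; at that time the equation itself bounds the drift. *)
Lemma drift_le M T t : 0 <= x0 -> 0 <= sigma ->
  (forall s, 0 <= s <= T -> `|b s| <= M) -> 0 <= t <= T ->
  drift t <= 1 + sigma * M + a * T.
Proof.
move=> x00 sigma0 bM /andP[t0 tT].
have M0 : 0 <= M by apply: le_trans (bM 0 _); rewrite ?lexx ?(le_trans t0 tT).
have sM0 : 0 <= sigma * M by rewrite mulr_ge0.
(* If [A] is empty, the coefficient is at most [a] on all of (0, t]; otherwise [sup A] is the last
   time at level at most 1. *)
pose A := [set s | 0 <= s <= t /\ x s <= 1].
have [A0|A0] := pselect (A !=set0); last first.
  have x1 u : 0 < u <= t -> 1 < x u.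
    move=> /andP[u0 ut]; rewrite ltNge; apply/negP => xu; apply: A0; exists u.
    by split => //; rewrite (ltW u0).
  have := driftB_le 0 t; rewrite lexx t0 drift0 !subr0 => /(_ isT x1) h.
  have : a * t <= a * T by rewrite ler_pM2l.
  lra.
have Aub : has_ubound A by exists t => s [/andP[]].
pose tau := sup A.
have taut : tau <= t by apply: ge_sup => // s [/andP[]].
have tau0 : 0 <= tau.
  by case: (A0) => s As; apply: le_trans (ub_le_sup Aub As); case: As => /andP[].
(* By continuity, [1 < x tau] would persist near [tau], where [A] has points. *)
have xtau : x tau <= 1.
  rewrite leNgt; apply/negP => x1.
  have := proj1 (subspace_continuousP _ _) (proj1 solx) tau.
  rewrite /= in_itv/= andbT => /(_ tau0) /cvgr_gt /(_ _ x1).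
  rewrite near_withinE => /nbhs_ballP [e /= e0 he].
  have [s As stau] := sup_adherent e0 (conj A0 Aub).
  have s_le := ub_le_sup Aub As.
  case: As => /andP[s0 st]; rewrite leNgt => /negP; apply; apply: he.
    by rewrite /ball/= ger0_norm ?subr_ge0//; rewrite ltrBlDl -ltrBlDr.
  by rewrite /= in_itv/= s0.
have x1 u : tau < u <= t -> 1 < x u.
  move=> /andP[tu ut]; rewrite ltNge; apply/negP => xu.
  have : A u by split => //; rewrite ut andbT (le_trans tau0 (ltW tu)).
  by move=> /(ub_le_sup Aub); rewrite leNgt tu.
have := driftB_le tau t; rewrite tau0 taut => /(_ isT x1) h.
(* With [x tau <= 1] and [0 <= x0], the equation bounds the drift up to [tau] by 1 - sigma * b
   tau. *)
have := driftE tau tau0.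
have : - (sigma * b tau) <= sigma * M.
  rewrite -mulrN ler_wpM2l// (le_trans (ler_norm _))// normrN bM//.
  by rewrite tau0 (le_trans taut).
have : a * (t - tau) <= a * T by rewrite ler_pM2l// lerBlDr (le_trans tT)// lerDl.
lra.
Qed.

End drift.

(** [D] is what remains of X after removing the start and the noise. The uniform drift bound makes
    it the real limit of the regularized drifts, from which it inherits its value at 0 and its
    monotonicity. *)
Lemma rough_bessel_path {R : realType} (x0 a sigma T M : R) (b : R -> R)
    (xe : R -> R -> R) (X : R -> \bar R) :
  0 < x0 -> 0 < a -> 0 < sigma ->
  (forall s, 0 <= s <= T -> `|b s| <= M) ->
  (forall eps, 0 < eps -> regularized_solution x0 a sigma eps b (xe eps)) ->
  (forall t, 0 <= t -> (xe eps t)%:E @[eps --> 0^'+] --> X t) ->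
  exists D : R -> R,
    [/\ forall t, 0 <= t <= T -> fine (X t) = x0 + D t + sigma * b t,
        0 <= T -> D 0 = 0 & forall s t, 0 <= s <= t -> t <= T -> D s <= D t].
Proof.
move=> x00 a0 sigma0 bM sol cvgX.
pose D t := fine (X t) - x0 - sigma * b t.
pose De eps t := xe eps t - x0 - sigma * b t.
have DeE eps t : 0 < eps -> 0 <= t -> De eps t = drift a eps (xe eps) t.
  by move=> e0 t0; rewrite /De (driftE _ _ _ _ _ _ (sol _ e0))//; ring.
have near0 : \forall eps \near 0^'+, 0 < eps :> R by exact: nbhs_right_gt.
have cvgD t : 0 <= t <= T -> De eps t @[eps --> 0^'+] --> D t.
  move=> t0T; have /andP[t0 tT] := t0T.
  apply: cvgB; last exact: cvg_cst.
  apply: cvgB; last exact: cvg_cst.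
  (* The two bounds make [X t] finite, so that [fine] is continuous there and its default value at
     infinity cannot occur. *)
  have up : (X t <= (x0 + (1 + sigma * M + a * T) + sigma * b t)%:E)%E.
    apply: cvge_le (cvgX t t0); near=> eps.
    have e0 : 0 < eps by near: eps.
    rewrite lee_fin (driftE _ _ _ _ _ _ (sol _ e0))// lerD2r lerD2l.
    by apply: (drift_le _ _ _ _ _ _ _ _ (sol _ e0)) => //; exact: ltW.
  have lo : ((x0 + sigma * b t)%:E <= X t)%E.
    apply: cvge_ge (cvgX t t0); near=> eps.
    have e0 : 0 < eps by near: eps.
    rewrite lee_fin (driftE _ _ _ _ _ _ (sol _ e0))// lerD2r lerDl.
    rewrite -(drift0 a eps (xe eps)).
    by apply: (le_drift _ _ _ _ _ _ _ _ (sol _ e0)) => //; rewrite lexx.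
  have finX : X t \is a fin_num.
    by rewrite fin_numE; apply/andP; split; apply/eqP => XE;
       move: up lo; rewrite XE// leye_eq.
  have := cvgX t t0; rewrite -(fineK finX) => /fine_cvg.
  exact.
exists D; split.
- by move=> t _; rewrite /D; ring.
- move=> T0; have c0 : (0 : R) <= 0 <= T by rewrite lexx.
  apply: (cvg_unique _ (cvgD 0 c0)) => //.
  apply: cvg_near_cst; near=> eps.
  by rewrite DeE ?drift0//; near: eps.
- move=> s t /andP[s0 st] tT.
  have t0 := le_trans s0 st.
  have cs : 0 <= s <= T by rewrite s0 (le_trans st).
  have ct : 0 <= t <= T by rewrite t0.
  apply: (ler_cvg_to (cvgD s cs) (cvgD t ct)); near=> eps.
  have e0 : 0 < eps by near: eps.
  rewrite !DeE//; apply: (le_drift _ _ _ _ _ _ _ _ (sol _ e0)) => //.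
  by rewrite s0.
Unshelve. all: by end_near.
Qed.

(** * Consistency of the estimator *)

Section squared_variations.
Context {R : realType}.

(** Young's inequality for the cross terms charges only a fraction [theta] of the dominant sum, that
    of [y]; the cost falls on the bounded sum, that of [x]. *)
Lemma sum_sqrD_dist n (x y : nat -> R) (theta : R) : 0 < theta ->
  `|\sum_(k < n) (x k + y k) ^+ 2 - \sum_(k < n) y k ^+ 2| <=
  (1 + theta^-1) * \sum_(k < n) x k ^+ 2 + theta * \sum_(k < n) y k ^+ 2.
Proof.
move=> theta0; rewrite -sumrB !mulr_sumr -big_split/=.
apply: le_trans (ler_norm_sum _ _ _) _; apply: ler_sum => k _.
move: (x k) (y k) => {x y}u v.
have amgm : 2 * `|u * v| <= theta^-1 * u ^+ 2 + theta * v ^+ 2.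
  have h1 : 0 <= theta^-1 * (u - theta * v) ^+ 2.
    by rewrite mulr_ge0 ?sqr_ge0// invr_ge0 ltW.
  have h2 : 0 <= theta^-1 * (u + theta * v) ^+ 2.
    by rewrite mulr_ge0 ?sqr_ge0// invr_ge0 ltW.
  have e1 : theta^-1 * (u - theta * v) ^+ 2 =
      theta^-1 * u ^+ 2 + theta * v ^+ 2 - 2 * (u * v) by field; rewrite gt_eqF.
  have e2 : theta^-1 * (u + theta * v) ^+ 2 =
      theta^-1 * u ^+ 2 + theta * v ^+ 2 + 2 * (u * v) by field; rewrite gt_eqF.
  move: h1 h2; rewrite e1 e2; case: (ler0P (u * v)) => _; lra.
have -> : (u + v) ^+ 2 - v ^+ 2 = u ^+ 2 + 2 * (u * v) by ring.
apply: le_trans (ler_normD _ _) _.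
rewrite (normrM 2) (ger0_norm (ler0n R 2)) (ger0_norm (sqr_ge0 u)); lra.
Qed.

Lemma sum_sqr_incr_le n (D : nat -> R) : (forall k, (k < n)%N -> D k <= D k.+1) ->
  \sum_(k < n) (D k.+1 - D k) ^+ 2 <= (D n - D 0%N) ^+ 2.
Proof.
move=> nD.
(* The induction also carries [D 0 <= D n], which makes the cross term of the expanded square
   nonnegative. *)
suff [] : \sum_(k < n) (D k.+1 - D k) ^+ 2 <= (D n - D 0%N) ^+ 2 /\ D 0%N <= D n by [].
elim: n nD => [|n ih] nD; first by rewrite big_ord0 subrr expr0n.
have [|h1 h2] := ih; first by move=> k kn; apply: nD; exact: ltnW.
have h3 := nD n (ltnSn n).
rewrite big_ord_recr/=; split; last exact: le_trans h3.
have : 0 <= (D n.+1 - D n) * (D n - D 0%N) by rewrite mulr_ge0 ?subr_ge0.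
have -> : (D n.+1 - D 0%N) ^+ 2 = (D n.+1 - D n) ^+ 2 + (D n - D 0%N) ^+ 2
  + 2 * ((D n.+1 - D n) * (D n - D 0%N)) by ring.
lra.
Qed.

(** A second difference is a difference of two increments, so its square is at most twice the sum of
    their squares; each increment occurs in at most two of them, hence 4. *)
Lemma sum_sqr_incr2_le n (D : nat -> R) : (forall k, (k < n)%N -> D k <= D k.+1) ->
  \sum_(k < n.-1) (D k.+2 - 2 * D k.+1 + D k) ^+ 2 <= 4 * (D n - D 0%N) ^+ 2.
Proof.
move=> /sum_sqr_incr_le; case: n => [|n] h.
  by rewrite big_ord0 subrr expr0n mulr0.
apply: (@le_trans _ _ (4 * \sum_(k < n.+1) (D k.+1 - D k) ^+ 2)); last by rewrite ler_pM2l.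
apply: (@le_trans _ _ (\sum_(k < n) (2 * (D k.+2 - D k.+1) ^+ 2 + 2 * (D k.+1 - D k) ^+ 2))).
  apply: ler_sum => k _; move: (D k.+2) (D k.+1) (D k) => x y z.
  have -> : 2 * (x - y) ^+ 2 + 2 * (y - z) ^+ 2 =
    (x - 2 * y + z) ^+ 2 + (x - z) ^+ 2 by ring.
  by rewrite lerDl sqr_ge0.
rewrite big_split/= -!mulr_sumr.
have h1 : \sum_(k < n) (D k.+2 - D k.+1) ^+ 2 <= \sum_(k < n.+1) (D k.+1 - D k) ^+ 2.
  by rewrite [leRHS]big_ord_recl/= lerDr sqr_ge0.
have h2 : \sum_(k < n) (D k.+1 - D k) ^+ 2 <= \sum_(k < n.+1) (D k.+1 - D k) ^+ 2.
  by rewrite [leRHS]big_ord_recr/= lerDl sqr_ge0.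
lra.
Qed.

Lemma V_drift_dist (x0 sigma T theta : R) (n : nat) (xi D b : R -> R) :
  0 < theta -> 0 < T -> (0 < n)%N ->
  (forall t, 0 <= t <= T -> xi t = x0 + D t + sigma * b t) ->
  D 0 = 0 -> (forall s t, 0 <= s <= t -> t <= T -> D s <= D t) ->
  `|V12 T n xi - sigma ^+ 2 * V12 T n b| <=
    (1 + theta^-1) * D T ^+ 2 + theta * (sigma ^+ 2 * V12 T n b) /\
  `|V22 T n xi - sigma ^+ 2 * V22 T n b| <=
    (1 + theta^-1) * (4 * D T ^+ 2) + theta * (sigma ^+ 2 * V22 T n b).
Proof.
move=> theta0 T0 n0 xiE D0 nD.
have nR : 0 < n%:R :> R by rewrite ltr0n.
have g0 k : 0 <= grid T n k by rewrite /grid divr_ge0 ?(ltW nR)// mulr_ge0 ?(ltW T0).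
have gS k : grid T n k <= grid T n k.+1.
  by rewrite /grid ler_pM2r ?invr_gt0// ler_pM2r// ler_nat.
have gT k : (k <= n)%N -> 0 <= grid T n k <= T.
  by move=> kn; rewrite g0/= /grid ler_pdivrMr// mulrC ler_pM2l// ler_nat.
have gn : grid T n n = T by rewrite /grid mulrAC divff ?mul1r// gt_eqF.
have g00 : grid T n 0 = 0 by rewrite /grid !mul0r.
have nDg k : (k < n)%N -> D (grid T n k) <= D (grid T n k.+1).
  move=> kn; apply: nD; first by rewrite g0 gS.
  by have /andP[] := gT _ kn.
have t0 : 0 <= 1 + theta^-1 by rewrite addr_ge0// invr_ge0 ltW.
split.
- have -> : V12 T n xi = \sum_(k < n) ((D (grid T n k.+1) - D (grid T n k))
      + sigma * (b (grid T n k.+1) - b (grid T n k))) ^+ 2.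
    by apply: eq_bigr => k _; rewrite !xiE ?gT// ?(ltnW (ltn_ord k))//; congr (_ ^+ 2); ring.
  have -> : sigma ^+ 2 * V12 T n b =
      \sum_(k < n) (sigma * (b (grid T n k.+1) - b (grid T n k))) ^+ 2.
    by rewrite mulr_sumr; apply: eq_bigr => k _; rewrite exprMn.
  apply: le_trans (sum_sqrD_dist _ (fun k => D (grid T n k.+1) - D (grid T n k))
    (fun k => sigma * (b (grid T n k.+1) - b (grid T n k))) _ theta0) _.
  rewrite lerD2r ler_wpM2l//.
  by have := sum_sqr_incr_le _ (fun k => D (grid T n k)) nDg; rewrite gn g00 D0 subr0.
- have -> : V22 T n xi = \sum_(k < n.-1)
      ((D (grid T n k.+2) - 2 * D (grid T n k.+1) + D (grid T n k))
      + sigma * (b (grid T n k.+2) - 2 * b (grid T n k.+1) + b (grid T n k))) ^+ 2.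
    apply: eq_bigr => k _.
    have kn : (k.+2 <= n)%N by move: (ltn_ord k); rewrite -ltnS prednK.
    rewrite !xiE ?gT// ?(ltnW kn)// ?(ltnW (ltnW kn))//; congr (_ ^+ 2); ring.
  have -> : sigma ^+ 2 * V22 T n b = \sum_(k < n.-1)
      (sigma * (b (grid T n k.+2) - 2 * b (grid T n k.+1) + b (grid T n k))) ^+ 2.
    by rewrite mulr_sumr; apply: eq_bigr => k _; rewrite exprMn.
  apply: le_trans (sum_sqrD_dist _
    (fun k => D (grid T n k.+2) - 2 * D (grid T n k.+1) + D (grid T n k))
    (fun k => sigma * (b (grid T n k.+2) - 2 * b (grid T n k.+1) + b (grid T n k)))
    _ theta0) _.
  rewrite lerD2r ler_wpM2l//.
  by have := sum_sqr_incr2_le _ (fun k => D (grid T n k)) nDg; rewrite gn g00 D0 subr0.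
Qed.

(** At the point (s, s (4 - 2^(2H))) the scale s cancels and the logarithm is that of 2^(2H), so the
    value is H; the map is continuous there. *)
Lemma estimator_continuous (H s delta : R) : 0 < s -> 0 < delta ->
  exists2 e : R, 0 < e & forall v1 v2 : R,
    `|v1 - s| < e -> `|v2 - s * (4 - 2 `^ (2 * H))| < e ->
    `|ln (4 - v2 / v1) / (2 * ln 2) - H| <= delta.
Proof.
move=> s0 delta0; set k := 4 - _.
have ln20 : 0 < ln 2 :> R by rewrite ln_gt0// ltr1n.
have c : ln (4 - p.2 / p.1) / (2 * ln 2) @[p --> (s, s * k)] --> H.
  have -> : H = ln (4 - s * k / s) / (2 * ln 2).
    rewrite mulrAC divff ?gt_eqF// mul1r /k subKr ln_powR; field.
    by rewrite gt_eqF.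
  apply: cvgM; last exact: cvg_cst.
  apply: (cvg_comp (fun p : R * R => 4 - p.2 / p.1) (@ln R)); last first.
    apply: continuous_ln.
    by rewrite mulrAC divff ?gt_eqF// mul1r /k subKr powR_gt0.
  apply: cvgB; first exact: cvg_cst.
  apply: cvgM; first exact: cvg_snd.
  by apply: cvgV; [rewrite gt_eqF|exact: cvg_fst].
move/cvgrPdist_le : c => /(_ _ delta0) /nbhs_ballP[e /= e0 he].
exists e => // v1 v2 h1 h2; rewrite distrC; apply: (he (v1, v2)); split => /=.
  by rewrite /ball/= distrC.
by rewrite /ball/= distrC.
Qed.

End squared_variations.

(** * Limits along 1/(n+1) and growth of the quadratic variation *)

Section limits.
Context {R : realType}.

Lemma harmonic_at_right : @harmonic R n @[n --> \oo] --> 0^'+.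
Proof.
move=> A [e /= e0 he].
have h : \forall n \near \oo, @harmonic R n < e.
  exact: (cvgr_lt _ (@cvg_harmonic R)).
suff : \forall n \near \oo, A (@harmonic R n) by [].
near=> n.
have hn : 0 < @harmonic R n by rewrite /harmonic/= invr_gt0.
apply: he => //; rewrite /ball/= sub0r normrN gtr0_norm//.
by near: n.
Unshelve. all: by end_near.
Qed.

(** The inverse equals T^(-p) (1/n)^(1-p), with a positive exponent 1 - p. This is where H < 1/2
    makes the noise dominate the drift. *)
Lemma cvg_inv_scale (T p : R) : 0 < T -> p < 1 ->
  (n%:R * (T / n%:R) `^ p)^-1 @[n --> \oo] --> 0.
Proof.
move=> T0 p1; rewrite -cvg_shiftS/=.
have e n : (n.+1%:R * (T / n.+1%:R) `^ p)^-1 = (T `^ p)^-1 * (@harmonic R n) `^ (1 - p).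
  have hn : 0 < @harmonic R n by rewrite /harmonic/= invr_gt0.
  rewrite -[X in (X * _)^-1]invrK (_ : n.+1%:R^-1 = @harmonic R n)//.
  move: (harmonic n) hn => y y0; rewrite powRM ?(ltW T0) ?(ltW y0)//.
  rewrite powRB; last by rewrite gt_eqF// implybT.
  by rewrite powRr1 ?(ltW y0)//; field; rewrite !gt_eqF ?powR_gt0.
have : (T `^ p)^-1 * (@harmonic R n) `^ (1 - p) @[n --> \oo] --> (T `^ p)^-1 * 0.
  apply: cvgM; first exact: cvg_cst.
  apply: (cvg_comp _ (fun a => a `^ (1 - p)) harmonic_at_right).
  by apply: powR_cvg0; rewrite subr_gt0.
by rewrite mulr0 => lim; under eq_cvg do rewrite e.
Qed.

End limits.

Section deviation.
Context {R : realType}.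

(* Here A1, A2 stand for the variations of the driving noise, V1, V2 for those of the
   solution, DT for the total drift and m for the expected quadratic variation. *)
Lemma normalized_variations_close (H sigma T K e : R) : 0 < H -> H < 2^-1 -> 0 < sigma ->
  0 < T -> 0 < e ->
  exists theta e1 : R, [/\ 0 < theta, 0 < e1 &
   \forall n \near \oo, forall A1 A2 V1 V2 DT : R,
    let m := n%:R * (T / n%:R) `^ (2 * H) in
    let kappa := 4 - 2 `^ (2 * H) in
    0 <= DT <= K ->
    `|A1 - m| < e1 * m ->
    `|A2 - n.-1%:R * ((T / n%:R) `^ (2 * H) * kappa)| < e1 * m ->
    `|V1 - sigma ^+ 2 * A1| <=
      (1 + theta^-1) * DT ^+ 2 + theta * (sigma ^+ 2 * A1) ->
    `|V2 - sigma ^+ 2 * A2| <=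
      (1 + theta^-1) * (4 * DT ^+ 2) + theta * (sigma ^+ 2 * A2) ->
    `|V1 / m - sigma ^+ 2| < e /\ `|V2 / m - sigma ^+ 2 * kappa| < e].
Proof.
move=> H0 H12 sigma0 T0 e0; set p := 2 * H; set kappa := 4 - _.
have p1 : p < 1 by rewrite /p -ltr_pdivlMl// mulr1.
have k4 : kappa <= 4 by rewrite /kappa lerBlDr lerDl powR_ge0.
have k0 : 0 <= kappa.
  rewrite subr_ge0 (@le_trans _ _ (2 `^ 1))//; last by rewrite powRr1// ler_nat.
  by rewrite ler_powR ?ltW// ltr1n.
set s := sigma ^+ 2; have s0 : 0 < s by rewrite exprn_gt0.
(* The bound e1 <= 1 keeps the normalized variations of the noise below 2 and 5, so the [theta]
   terms are at most 5 e / 40 = e / 8; the bound e / (8 s) makes the scaled deviation of the noise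
   at most e / 8. *)
pose theta := e / (40 * s); pose e1 := Num.min 1 (e / (8 * s)).
have theta0 : 0 < theta by rewrite divr_gt0// mulr_gt0.
have e10 : 0 < e1 by rewrite lt_min ltr01 divr_gt0// mulr_gt0.
have e11 : e1 <= 1 by rewrite ge_min lexx.
have e1s : s * e1 <= e / 8.
  rewrite (_ : e / 8 = s * (e / (8 * s))); last by field; rewrite gt_eqF.
  by rewrite ler_pM2l// ge_min lexx orbT.
have ths : theta * s = e / 40 by rewrite /theta; field; rewrite gt_eqF.
exists theta, e1; split => //.
set c := 1 + theta^-1.
have c0 : 0 < c by rewrite addr_gt0 ?invr_gt0.
have lim1 : 4 * c * K ^+ 2 * (n%:R * (T / n%:R) `^ p)^-1 @[n --> \oo] --> (0:R).
  rewrite -[X in _ --> X](mulr0 (4 * c * K ^+ 2)); apply: cvgM; first exact: cvg_cst.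
  exact: cvg_inv_scale.
(* Absorbs the mismatch between the n - 1 second differences and the normalization by n. *)
have lim2 : 4 * s * n%:R^-1 @[n --> \oo] --> (0:R).
  rewrite -[X in _ --> X](mulr0 (4 * s)); apply: cvgM; first exact: cvg_cst.
  by rewrite -cvg_shiftS; exact: cvg_harmonic.
have e80 : 0 < e / 8 by rewrite divr_gt0.
near=> n => A1 A2 V1 V2 DT; set q := _ `^ p; set m := _ * q => /= /andP[DT0 DTK] h1 h2 g1 g2.
have n0 : 0 < n%:R :> R by rewrite ltr0n; near: n; exact: nbhs_infty_gt.
have b1 : 4 * c * K ^+ 2 * m^-1 < e / 8 by rewrite /m /q; near: n; exact: (cvgr_lt _ lim1 _ e80).
have b2 : 4 * s * n%:R^-1 < e / 8 by near: n; exact: (cvgr_lt _ lim2 _ e80).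
have q0 : 0 < q by rewrite powR_gt0// divr_gt0.
have m0 : 0 < m by rewrite mulr_gt0.
have DK : DT ^+ 2 <= K ^+ 2 by rewrite ler_sqr ?nnegrE// (le_trans DT0).
have normE u : `|u * m| = `|u| * m.
  by rewrite normrM [X in _ * X = _]gtr0_norm.
have divE u : u / m * m = u by rewrite divfK// gt_eqF.
(* All variations are written as multiples of [m], which leaves estimates between normalized
   quantities. *)
have [a1 h1' e_a1] : exists2 a, `|a - 1| < e1 & A1 = a * m.
  by exists (A1 / m); rewrite ?divE// -(ltr_pM2r m0) -normE mulrBl divE mul1r.
have [a2 h2' e_a2] : exists2 a, `|a - (1 - n%:R^-1) * kappa| < e1 & A2 = a * m.
  exists (A2 / m); rewrite ?divE// -(ltr_pM2r m0) -normE mulrBl divE.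
  rewrite (_ : (1 - n%:R^-1) * kappa * m = n.-1%:R * (q * kappa))//.
  have -> : n.-1%:R = n%:R - 1 :> R by rewrite -subn1 natrB// -(ltr0n R).
  by rewrite /m; field; rewrite gt_eqF.
have [v1 e_v1] : exists v, V1 = v * m by exists (V1 / m); rewrite divfK// gt_eqF.
have [v2 e_v2] : exists v, V2 = v * m by exists (V2 / m); rewrite divfK// gt_eqF.
have g1' : `|v1 - s * a1| <= c * K ^+ 2 * m^-1 + theta * s * a1.
  rewrite -(ler_pM2r m0) -normE mulrBl -e_v1 -(mulrA s) -e_a1 mulrDl divE.
  apply: le_trans g1 _; rewrite -(mulrA _ a1) -e_a1 -(mulrA _ s) lerD2r.
  by rewrite ler_pM2l.
have g2' : `|v2 - s * a2| <= 4 * c * K ^+ 2 * m^-1 + theta * s * a2.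
  rewrite -(ler_pM2r m0) -normE mulrBl -e_v2 -(mulrA s) -e_a2 mulrDl divE.
  apply: le_trans g2 _; rewrite -(mulrA _ a2) -e_a2 -(mulrA _ s) lerD2r.
  by rewrite mulrCA mulrA ler_pM2l// mulr_gt0.
rewrite e_v1 e_v2 !mulfK ?gt_eqF//.
have K0 : 0 <= c * K ^+ 2 * m^-1.
  apply: mulr_ge0; last by rewrite invr_ge0 ltW.
  by apply: mulr_ge0 (sqr_ge0 _); exact: ltW.
have i0 : 0 <= n%:R^-1 :> R by rewrite invr_ge0 ltW.
move: h1'; rewrite ltr_norml => /andP[h11 h12].
move: h2'; rewrite ltr_norml => /andP[h21 h22].
have kn : n%:R^-1 * kappa <= 4 * n%:R^-1 by rewrite mulrC ler_wpM2r.
have kn0 : 0 <= n%:R^-1 * kappa by rewrite mulr_ge0.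
have t1 : theta * s * a1 <= e / 20.
  rewrite ths (_ : e / 20 = e / 40 * 2); last by field.
  rewrite ler_pM2l ?divr_gt0//; lra.
have t2 : theta * s * a2 <= e / 8.
  rewrite ths (_ : e / 8 = e / 40 * 5); last by field.
  rewrite ler_pM2l ?divr_gt0//; lra.
have d1 : `|s * a1 - s| <= e / 8.
  rewrite -[X in _ - X]mulr1 -mulrBr normrM gtr0_norm// (le_trans _ e1s)// ler_pM2l//.
  by rewrite ler_norml; apply/andP; split; lra.
have d2 : `|s * a2 - s * kappa| <= e / 8 + e / 8.
  rewrite -mulrBr normrM gtr0_norm//.
  apply: (@le_trans _ _ (s * (e1 + 4 * n%:R^-1))).
    by rewrite ler_pM2l// ler_norml; apply/andP; split; lra.
  by rewrite mulrDr; apply: lerD => //; rewrite mulrCA mulrA ltW.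
split.
- rewrite (_ : v1 - s = (v1 - s * a1) + (s * a1 - s)); last by ring.
  apply: le_lt_trans (ler_normD _ _) _; lra.
- rewrite (_ : v2 - s * kappa = (v2 - s * a2) + (s * a2 - s * kappa)); last by ring.
  apply: le_lt_trans (ler_normD _ _) _; lra.
Unshelve. all: by end_near.
Qed.

End deviation.

(** * Measurability of the variations, the estimator and the process *)

Section measurability.
Context {R : realType} {d} {Omega : measurableType d}.
Variables (T : R) (n : nat) (xi : R -> Omega -> R).
Hypothesis mxi : forall k, measurable_fun setT (xi (grid T n k)).

Lemma measurable_V12 : measurable_fun setT (fun w => V12 T n (xi ^~ w)).
Proof.
apply: measurable_sum => k; apply: measurable_funX.
by apply: measurable_funB; exact: mxi.
Qed.

Lemma measurable_V22 : measurable_fun setT (fun w => V22 T n (xi ^~ w)).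
Proof.
apply: measurable_sum => k; apply: measurable_funX.
apply: measurable_funD; last exact: mxi.
by apply: measurable_funB; [exact: mxi|apply: measurable_funM => //; exact: mxi].
Qed.

Lemma measurable_hurst_estimator :
  measurable_fun setT (fun w => hurst_estimator T n (xi ^~ w)).
Proof.
(* Since [V12] is nonnegative, its inverse is a real power, including the default value at 0. *)
have -> : (fun w => hurst_estimator T n (xi ^~ w)) = (fun w =>
    ln (4 - V22 T n (xi ^~ w) * (V12 T n (xi ^~ w)) `^ (-1)) * (2 * ln 2)^-1).
  apply/funext => w; rewrite powR_inv1//.
  by apply: sumr_ge0 => k _; exact: sqr_ge0.
apply: measurable_funM => //.
apply: (measurableT_comp (f := @ln R)); first exact: measurable_ln.
apply: measurable_funB => //; apply: measurable_funM; first exact: measurable_V22.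
apply: (measurableT_comp (f := @powR R ^~ (-1))); first exact: measurable_powR.
exact: measurable_V12.
Qed.

End measurability.

(** The limit is taken along the sequence eps = 1/(n+1), so it is a countable limit of measurable
    functions. *)
Lemma measurable_rough_bessel {R : realType} {d} {Omega : measurableType d}
  (P : probability Omega R) (x0 a sigma : R) (B : R -> {RV P >-> R})
  (X : R -> Omega -> \bar R) (t : R) : 0 <= t ->
  rough_bessel_process x0 a sigma B X -> measurable_fun setT (fun w => fine (X t w)).
Proof.
move=> t0 [Xeps [_ cvgX]].
apply: (measurableT_comp (f := @fine R)); first exact: fine_measurable.
apply: (emeasurable_fun_cvg (fun n w => (Xeps (@harmonic R n) t w)%:E)).
  by move=> n; apply/measurable_EFinP.
move=> w _; exact: (cvg_comp _ _ harmonic_at_right (cvgX t w t0)).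
Qed.

(** Continuity from above along the events [k < Y], whose intersection is empty because [Y] is
    real-valued. *)
Lemma tail_probability {R : realType} {d} {Omega : measurableType d}
  (P : probability Omega R) (Y : Omega -> R) (eta : R) : measurable_fun setT Y ->
  0 < eta -> exists K : R, (P [set w | K < Y w]%R <= eta%:E)%E.
Proof.
move=> mY eta0.
pose F k := [set w | k%:R < Y w].
have mF k : measurable (F k).
  by rewrite -[F k]setTI; apply: measurable_fun_ltr.
have cF : P \o F @ \oo --> P (\bigcap_k F k).
  apply: nonincreasing_cvg_mu => //.
  - by rewrite (le_lt_trans (probability_le1 _ _)) ?ltry.
  - exact: bigcapT_measurable.
  - move=> i j ij; apply/subsetPset => w; apply: le_lt_trans.
    by rewrite ler_nat.
have F0 : \bigcap_k F k = set0.
  apply/seteqP; split => // w /(_ (Num.bound `|Y w|) I).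
  rewrite /F/= ltNge => /negP; apply.
  by apply: le_trans (ler_norm _) _; apply: ltW; exact: archi_boundP (normr_ge0 _).
move: cF; rewrite F0 measure0 => /fine_cvgP[_ /cvgr_lt/(_ _ eta0)] [k _ hk].
exists k%:R; have := hk k (leqnn k) => /= /ltW.
by rewrite -lee_fin fineK// fin_num_measure.
Qed.

Theorem theorem3p4 (R : realType) (d : measure_display)
    (Omega : measurableType d) (P : probability Omega R)
    (H x0 a sigma T : R) (B : R -> {RV P >-> R}) (X : R -> Omega -> \bar R)
    (H_gt0 : 0 < H) (H_lt : H < 2^-1)
    (x0_gt0 : 0 < x0) (a_gt0 : 0 < a) (sigma_gt0 : 0 < sigma) (T_gt0 : 0 < T)
    (fbmB : fractional_brownian_motion H B)
    (besselX : rough_bessel_process x0 a sigma B X) :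
  cvg_in_probability P
    (fun n w => hurst_estimator T n (fun t => fine (X t w))) H.
Proof.
have TT : 0 <= T <= T by rewrite lexx ltW.
have grid_ge0 n k : 0 <= grid T n k by rewrite /grid divr_ge0// mulr_ge0// ltW.
have mX t : 0 <= t -> measurable_fun setT (fun w => fine (X t w)).
  by move=> t0; exact: measurable_rough_bessel besselX.
have mB t : measurable_fun setT (B t) by exact: measurable_funPT.
(* The total drift, written through [X] so that its measurability is visible; [path] identifies it
   with the final value of the monotone drift of each path. *)
pose DT w := fine (X T w) - x0 - sigma * B T w.
have mDT : measurable_fun setT DT.
  apply: measurable_funB; last exact: measurable_funM.
  by apply: measurable_funB => //; apply: mX; exact: ltW.
have path w : exists D : R -> R, [/\ D T = DT w, D 0 = 0,
    forall t, 0 <= t <= T -> fine (X t w) = x0 + D t + sigma * B t w &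
    forall s t, 0 <= s <= t -> t <= T -> D s <= D t].
  (* An admissible Hölder order, used to bound the noise path on [0, T]. *)
  have H2 : 0 < H / 2 < H by rewrite divr_gt0//= ltr_pdivrMr// ltr_pMr// ltr1n.
  have hB : locally_hoelder (H / 2) (fun t => B t w) by case: fbmB => _ _ _; exact.
  have [Xeps [sol cvgX]] := besselX.
  have [|M bM] := locally_hoelder_bounded (H / 2) T (fun t => B t w) _ T_gt0 hB.
    by rewrite divr_gt0.
  have [D [XE D0 Dnd]] := rough_bessel_path x0 a sigma T M (fun t => B t w)
    (fun e t => Xeps e t w) (X ^~ w) x0_gt0 a_gt0 sigma_gt0 bM
    (fun e e0 => sol e e0 w) (fun t t0 => cvgX t w t0).
  exists D; split => //; last by apply: D0; exact: ltW.
  by rewrite /DT XE//; ring.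
move=> delta delta0.
pose p := 2 * H; pose kappa : R := 4 - 2 `^ p.
have s2 : 0 < sigma ^+ 2 by rewrite exprn_gt0.
have [e e0 est] := estimator_continuous H (sigma ^+ 2) delta s2 delta0.
pose bad n := [set w | delta < `|hurst_estimator T n (fun t => fine (X t w)) - H|].
have mbad n : measurable (bad n).
  rewrite -[bad n]setTI; apply: measurable_fun_ltr => //.
  apply: measurableT_comp => //; apply: measurable_funB => //.
  by apply: (measurable_hurst_estimator T n (fun t w => fine (X t w))) => k; exact: mX.
suff main (eta : R) : 0 < eta -> \forall n \near \oo, (P (bad n) <= eta%:E)%E.
  apply/fine_cvgP; split.
    by apply: nearW => n; apply: fin_num_measure; exact: mbad.
  apply/cvgrPdist_le => eta eta0; near=> n.
  rewrite sub0r normrN ger0_norm ?fine_ge0//.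
  rewrite -lee_fin fineK; last by apply: fin_num_measure; exact: mbad.
  by near: n; exact: main.
move=> eta0.
have eta2 : 0 < eta / 2 by rewrite divr_gt0.
(* The total drift has no deterministic bound; it exceeds [K] with probability at most eta / 2. *)
have [K PK] := tail_probability P DT (eta / 2) mDT eta2.
have [theta [e1 [theta0 e10 close]]] :=
  normalized_variations_close H sigma T K e H_gt0 H_lt sigma_gt0 T_gt0 e0.
(* 68 = 4 + 64 adds the constants of the two deviation bounds. *)
have lim : (68 / e1 ^+ 2) / n%:R @[n --> \oo] --> (0 : R).
  rewrite -[X in _ --> X](mulr0 (68 / e1 ^+ 2)); apply: cvgM; first exact: cvg_cst.
  by rewrite -cvg_shiftS; exact: cvg_harmonic.
near=> n.
have n0 : (0 < n)%N by near: n; exact: nbhs_infty_gt.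
have nR : 0 < n%:R :> R by rewrite ltr0n.
have small : (68 / e1 ^+ 2) / n%:R < eta / 2.
  by near: n; exact: (cvgr_lt _ lim _ eta2).
pose q := (T / n%:R) `^ p; pose m := n%:R * q.
have m0 : 0 < m by rewrite mulr_gt0// powR_gt0// divr_gt0.
pose E0 := [set w | K < DT w].
pose E1 := [set w | e1 * m <= `|V12 T n (fun t => B t w) - m|].
pose E2 := [set w | e1 * m <=
  `|V22 T n (fun t => B t w) - n.-1%:R * (q * kappa)|].
have mE0 : measurable E0 by rewrite -[E0]setTI; exact: measurable_fun_ltr.
have mE1 : measurable E1.
  rewrite -[E1]setTI; apply: measurable_fun_ler => //.
  apply: measurableT_comp => //; apply: measurable_funB => //.
  exact: (measurable_V12 T n (fun t w => B t w)).
have mE2 : measurable E2.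
  rewrite -[E2]setTI; apply: measurable_fun_ler => //.
  apply: measurableT_comp => //; apply: measurable_funB => //.
  exact: (measurable_V22 T n (fun t w => B t w)).
have sub : bad n `<=` E0 `|` (E1 `|` E2).
  move=> w badw; apply: contrapT => /not_orP[/negP nE0 /not_orP[/negP nE1 /negP nE2]].
  have [D [DTE D0 XE Dnd]] := path w.
  have [d1 d2] := V_drift_dist x0 sigma T theta n (fun t => fine (X t w)) D
    (fun t => B t w) theta0 T_gt0 n0 XE D0 Dnd.
  have DTK : 0 <= D T <= K.
    rewrite -{1}D0 Dnd ?lexx ?(ltW T_gt0)//= DTE.
    by rewrite leNgt; exact: nE0.
  rewrite -ltNge in nE1; rewrite -ltNge in nE2.
  (* The rank n is fixed before the path [w]; [close] is uniform in the values of the variations, so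
     this is legitimate. *)
  have closen : forall A1 A2 V1 V2 DT : R,
    0 <= DT <= K ->
    `|A1 - m| < e1 * m ->
    `|A2 - n.-1%:R * (q * kappa)| < e1 * m ->
    `|V1 - sigma ^+ 2 * A1| <=
      (1 + theta^-1) * DT ^+ 2 + theta * (sigma ^+ 2 * A1) ->
    `|V2 - sigma ^+ 2 * A2| <=
      (1 + theta^-1) * (4 * DT ^+ 2) + theta * (sigma ^+ 2 * A2) ->
    `|V1 / m - sigma ^+ 2| < e /\ `|V2 / m - sigma ^+ 2 * kappa| < e.
    by rewrite /m /q; near: n; exact: close.
  have [c1 c2] := closen _ _ _ _ _ DTK nE1 nE2 d1 d2.
  move: badw; rewrite /bad/= ltNge => /negP; apply.
  (* The normalization by [m] cancels in the ratio of the two variations. *)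
  have := est _ _ c1 c2; rewrite /hurst_estimator.
  rewrite invf_div mulrA divfK// gt_eqF//.
apply: (@le_trans _ _ (P E0 + (P E1 + P E2))%E).
  apply: le_trans (le_measure P _ _ sub) _; rewrite ?inE//.
    by apply: measurableU => //; exact: measurableU.
  apply: le_trans (measureU2 _ _ _) _ => //; first exact: measurableU.
  by rewrite leeD2l// measureU2.
rewrite (splitr eta) EFinD; apply: leeD => //.
have P1 := V12_fbm_deviation H T B H_gt0 H_lt T_gt0 fbmB n n0 e1 e10.
have P2 := V22_fbm_deviation H T B H_gt0 H_lt T_gt0 fbmB n n0 e1 e10.
apply: le_trans (leeD P1 P2) _; rewrite -EFinD lee_fin.
rewrite (_ : _ + _ = (68 / e1 ^+ 2) / n%:R); first exact: ltW.
by field; rewrite !gt_eqF.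
Unshelve. all: by end_near.
Qed.
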